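(* Let $T,R>0$, $\alpha>1$, $\lambda,\mu>0$. For a goal $\theta\ge0$ let $x(T)$ be the final progress of the agent (defined in the context) under the generalized hyperbolic discount function $\gamma_t(s)=(1+\lambda(s-t))^{-\mu/\lambda}$. Let $\theta^*$ be the optimal goal when exploitative rewards are not permitted, i.e. the goal that maximizes $x(T)$ over $\theta\ge0$ subject to the constraint $x(T)=\theta$. Then $$\theta^*=\begin{cases}R^{\frac1\alpha}f_T(0)^{-\frac1\alpha}&\text{if }t_0\le0,\\ R^{\frac1\alpha}f_T(t_0)^{-\frac1\alpha}&\text{if }t_0>0,\end{cases}$$ where $f_T$ and $t_0$ are defined in the context.
   Context: Agent model. An agent receives a reward $R$ if its progress reaches the goal $\theta$ within the period $[0,T]$. The agent's state is $(t,x)$, with time $t\in[0,T]$ and progress $x\ge0$. Cost function: $c(\Delta)=\Delta^\alpha$ if $\Delta\ge0$ and $c(\Delta)=+\infty$ otherwise. $\mathcal Y_{t,x}$ is the set of absolutely continuous functions $y$ on $[t,T]$ with $y(t)=x$. The perceived cost of $y\in\mathcal Y_{t,x}$ is $$\mathcal P[y]=\int_t^T\gamma_t(s)\,c(y'(s))\,ds-\gamma_t(T)\,R\cdot\mathbf 1[y(T)\ge\theta].$$ At state $(t,x)$ the agent selects $y^*_{t,x}:=\operatorname{argmin}_{y\in\mathcal Y_{t,x}}\mathcal P[y]$; if the minimizer is not unique, one that maximizes the initial derivative $\left.\frac{d\,y^*_{t,x}(s)}{ds}\right|_{s=t}$ is chosen. The agent's trajectory $x(t)$, $t\in[0,T]$,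 for goal $\theta$ is determined by $$\frac{dx(t)}{dt}=\left.\frac{d\,y^*_{t,x(t)}(s)}{ds}\right|_{s=t},\qquad x(0)=0.$$ Definitions: $$\eta(t):=\int_0^t\frac{ds}{\bigl(1+\lambda(T-s)\bigr)^{\frac{\mu}{\lambda(\alpha-1)}+1}-1},$$ $$f_T(t):=\left(\frac{\mu+\lambda(\alpha-1)}{(\alpha-1)\left[\bigl(1+\lambda(T-t)\bigr)^{\frac{\mu}{\lambda(\alpha-1)}+1}-1\right]}\right)^{\alpha-1}\bigl(1+\lambda(T-t)\bigr)^{\frac{\mu}{\lambda}}\exp\left(-\alpha\left(\frac{\mu}{\alpha-1}+\lambda\right)\eta(t)\right).$$ $x_0$ denotes the unique real solution with $x>1$ of $$(\alpha-1)x^{\frac{\mu}{\lambda}+\alpha-1}-\alpha\left(\frac{\mu}{\lambda(\alpha-1)}+1\right)x^{\alpha-1}+\frac{\mu}{\lambda}=0,$$ and $t_0:=T-\frac{x_0^{\alpha-1}-1}{\lambda}$. *)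

(* Defs.v *)
From HB Require Import structures.
From mathcomp Require Import all_boot all_order all_algebra.
From mathcomp Require Import all_classical all_reals all_analysis.

Set Implicit Arguments.
Unset Strict Implicit.
Unset Printing Implicit Defensive.
Import Order.TTheory GRing.Theory Num.Theory.
Import numFieldNormedType.Exports.
Local Open Scope classical_set_scope.
Local Open Scope ring_scope.

Definition absolutely_continuous {K : realType} (a b : K) (f : K -> K) : Prop :=
  forall e : K, 0 < e -> exists2 d : K, 0 < d &
    forall (n : nat) (l r : 'I_n -> K),
      (forall i, [/\ a <= l i, l i <= r i & r i <= b]) ->
      trivIset [set: 'I_n] (fun i => `]l i, r i[%classic) ->
      \sum_(i < n) (r i - l i) < d ->
      \sum_(i < n) `|f (r i) - f (l i)| < e.

Definition right_derivative {K : realType} (y : K -> K) (t v : K) : Prop :=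
  h^-1 * (y (t + h) - y t) @[h --> 0^'+] --> v.

Section Agent.
Context {K : realType}.
(* [gamma t s] is the discount factor applied at time t to time s. *)
Variables (T R alpha : K) (gamma : K -> K -> K) (theta : K).

Definition effort_cost (v : K) : \bar K :=
  if 0 <= v then (v `^ alpha)%:E else +oo%E.

(* Plans are total functions; only their values on [t, T] matter.  An absolutely
   continuous plan is differentiable almost everywhere on ]t, T[, so the junk
   values of [derive1 y] do not contribute to the integral. *)
Definition admissible (t x : K) (y : K -> K) : Prop :=
  absolutely_continuous t T y /\ y t = x.

Definition perceived_cost (t : K) (y : K -> K) : \bar K :=
  (\int[lebesgue_measure]_(s in `[t, T])
      ((gamma t s)%:E * effort_cost (derive1 y s))
   - (gamma t T * R * (theta <= y T)%R%:R)%:E)%E.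

Definition optimal_plan (t x : K) (y : K -> K) : Prop :=
  admissible t x y /\
  forall z, admissible t x z -> (perceived_cost t y <= perceived_cost t z)%E.

(* Ties between optimal plans are broken by the largest initial slope. *)
Definition chosen_velocity (t x v : K) : Prop :=
  (exists2 y, optimal_plan t x y & right_derivative y t v) /\
  forall z w, optimal_plan t x z -> right_derivative z t w -> w <= v.

(* The right-hand side jumps to 0 when the agent gives up, so the equation is
   understood in the sense of Caratheodory. *)
Definition solves_agent_ode (x : K -> K) : Prop :=
  [/\ absolutely_continuous 0 T x, x 0 = 0 &
      {ae lebesgue_measure, forall t, t \in `[0, T] ->
        exists2 v, chosen_velocity t (x t) v & is_derive t 1 x v}].

(* When the state only touches the give-up threshold, giving up there also
   solves the equation almost everywhere, although the tie-breaking rule tells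
   the agent to keep working at that instant.  In accordance with that rule the
   trajectory is the largest solution, which makes it unique on [0, T]. *)
Definition agent_trajectory (x : K -> K) : Prop :=
  solves_agent_ode x /\
  forall z, solves_agent_ode z -> forall t, t \in `[0, T] -> z t <= x t.

Definition final_progress (p : K) : Prop :=
  exists2 x, agent_trajectory x & x T = p.

End Agent.

Definition optimal_goal {K : realType} (T R alpha : K) (gamma : K -> K -> K)
    (theta : K) : Prop :=
  0 <= theta /\
  exists p, [/\ final_progress T R alpha gamma theta p, p = theta &
    forall theta' p', 0 <= theta' ->
      final_progress T R alpha gamma theta' p' -> p' = theta' -> p' <= p].

Definition hyperbolic_discount {K : realType} (lambda mu : K) (t s : K) : K :=
  (1 + lambda * (s - t)) `^ (- (mu / lambda)).

Section ClosedForm.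
Context {K : realType}.
Variables (T alpha lambda mu : K).

Definition eta (t : K) : K :=
  \int[lebesgue_measure]_(s in `[0, t])
    ((1 + lambda * (T - s)) `^ (mu / (lambda * (alpha - 1)) + 1) - 1)^-1.

Definition fT (t : K) : K :=
  ((mu + lambda * (alpha - 1)) /
   ((alpha - 1) *
    ((1 + lambda * (T - t)) `^ (mu / (lambda * (alpha - 1)) + 1) - 1)))
    `^ (alpha - 1)
  * (1 + lambda * (T - t)) `^ (mu / lambda)
  * expR (- (alpha * (mu / (alpha - 1) + lambda) * eta t)).

(* For alpha > 1 and lambda, mu > 0 this set is a singleton. *)
Definition x0 : K :=
  get [set x : K | 1 < x /\
    (alpha - 1) * x `^ (mu / lambda + alpha - 1)
    - alpha * (mu / (lambda * (alpha - 1)) + 1) * x `^ (alpha - 1)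
    + mu / lambda = 0].

Definition t0 : K := T - (x0 `^ (alpha - 1) - 1) / lambda.

End ClosedForm.

(* Main.v *)
(* Write w = 1 + lambda (T - t), kappa = mu / (lambda (alpha - 1)) + 1 and
   G(t) = (w ^ kappa - 1) / (lambda kappa), the integral over [t, T] of
   gamma_t ^ (-1 / (alpha - 1)).  By Young's inequality (in the form of a
   tangent-line bound) the cheapest way from x to theta at time t costs
   (theta - x) ^ alpha / G(t) ^ (alpha - 1) and starts at speed
   (theta - x) / G(t), so the agent moves only if this cost is at most
   gamma_t(T) R.  Pursuing without interruption gives
   theta - x(t) = theta exp (- lambda kappa eta(t)), and the condition at time t
   becomes theta ^ alpha * f_T(t) <= R.  Hence theta is reached iff
   theta ^ alpha * max f_T <= R: once the condition fails the agent stops, and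
   it never resumes because the affordable distance decreases with t.  Finally
   (ln f_T)' has the sign of (alpha - 1) w ^ kappa - alpha kappa w + mu / lambda,
   which is convex in w and negative at w = 1, so f_T peaks at max(t_0, 0).

   Arbitrary absolutely continuous plans and trajectories are handled through
   the fundamental theorem of calculus: an absolutely continuous function is a
   difference of monotone ones, whose Stieltjes measures are dominated by the
   Lebesgue measure, and Radon-Nikodym and Lebesgue differentiation apply. *)
Require Import Defs.
From HB Require Import structures.
From mathcomp Require Import all_boot all_order all_algebra.
From mathcomp Require Import all_classical all_reals all_analysis.
From mathcomp Require Import ring lra.
Set Implicit Arguments.
Unset Strict Implicit.
Unset Printing Implicit Defensive.
Import Order.TTheory GRing.Theory Num.Theory.
Import numFieldNormedType.Exports.
Local Open Scope classical_set_scope.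
Local Open Scope ring_scope.

(** * Finite families of intervals *)

Section IntervalLists.
Context {K : realType}.
Implicit Types (p q x y : K * K) (s t : seq (K * K)).

Definition sep p q := (p.2 <= q.1) || (q.2 <= p.1).

Definition within (a b : K) p := [&& a <= p.1, p.1 <= p.2 & p.2 <= b].

Definition total_length s := \sum_(p <- s) (p.2 - p.1).

(** Lists can be concatenated, refined and merged by recursion, which families indexed by ['I_n] do
    not allow conveniently. *)
Lemma absolutely_continuous_seq (a b : K) (f : K -> K) :
  absolutely_continuous a b f -> forall e : K, 0 < e -> exists2 d : K, 0 < d &
  forall s, all (within a b) s -> pairwise sep s -> total_length s < d ->
  \sum_(p <- s) `|f p.2 - f p.1| < e.
Proof.
move=> acf e e0; have [d d0 fd] := acf e e0; exists d => // s sab ss sd.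
have := fd (size s) (fun i => (nth (0, 0) s i).1) (fun i => (nth (0, 0) s i).2).
rewrite /total_length !(big_nth (0, 0)) !big_mkord in sd *; apply => //.
  by move=> i; have /(all_nthP (0, 0)) /(_ i (ltn_ord i)) /and3P := sab.
move/(pairwiseP (0, 0)) : ss => ss i j _ _ [z [/=]]; rewrite !in_itv/=.
move=> /andP[zi1 zi2] /andP[zj1 zj2]; apply/eqP/negPn/negP => ij.
wlog ltij : i j ij zi1 zi2 zj1 zj2 / (i < j)%N => [H|].
  have [h|h|/val_inj h] := ltngtP i j; [exact: (H i j)| |by rewrite h eqxx in ij].
  by apply: (H j i) => //; rewrite eq_sym.
by have /orP[] := ss i j (ltn_ord i) (ltn_ord j) ltij; lra.
Qed.

Fixpoint merge_itv x s : seq (K * K) :=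
  if s is y :: s' then
    if sep x y then y :: merge_itv x s'
    else merge_itv (Num.min x.1 y.1, Num.max x.2 y.2) s'
  else [:: x].

Definition wf_itv p := p.1 <= p.2.

Lemma merge_itv_all (P : pred (K * K)) x s :
  (forall x y, wf_itv x -> wf_itv y -> ~~ sep x y -> P x -> P y ->
    P (Num.min x.1 y.1, Num.max x.2 y.2)) ->
  all wf_itv (x :: s) -> all P (x :: s) -> all P (merge_itv x s).
Proof.
move=> HP; elim: s x => [|y s IH] x //= /and3P[wx wy ws] /and3P[Px Py Ps].
case: ifPn => [_|sxy] /=; first by rewrite Py IH//= ?wx ?Px.
apply: IH; rewrite /= ?Ps ?ws ?andbT; last exact: HP.
by rewrite /wf_itv/= ge_min !le_max; apply/orP; left; apply/orP; left.
Qed.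

Lemma merge_itv_wf x s : all wf_itv (x :: s) -> all wf_itv (merge_itv x s).
Proof.
move=> w; apply: merge_itv_all => // {w} u v wu wv _ _ _.
by rewrite /wf_itv/= ge_min !le_max; apply/orP; left; apply/orP; left.
Qed.

(** An interval [y] that has been passed over stays separated from the growing hull: two overlapping
    intervals, both separated from [y], lie on the same side of it. *)
Lemma merge_itv_pairwise x s : all wf_itv (x :: s) -> pairwise sep s ->
  pairwise sep (merge_itv x s).
Proof.
elim: s x => [|y s IH] x //= /and3P[wx wy ws] /andP[ys ss].
case: ifPn => [sxy|sxy] /=; last first.
  apply: IH => //=; rewrite ws andbT.
  by rewrite /wf_itv/= ge_min !le_max; apply/orP; left; apply/orP; left.
apply/andP; split; last by apply: IH => //=; rewrite wx.
apply: merge_itv_all => /=; [|by rewrite wx|by rewrite ys andbT /sep orbC].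
move=> u v; move: wy; rewrite /wf_itv /sep/= le_min ge_max.
move=> wy wu wv; rewrite negb_or -!ltNge => /andP[uv1 uv2].
by move=> /orP[h1|h1] /orP[h2|h2]; rewrite ?h1 ?h2 ?orbT//; exfalso; lra.
Qed.

Lemma total_length_merge_itv x s : all wf_itv (x :: s) ->
  total_length (merge_itv x s) <= total_length (x :: s).
Proof.
rewrite /total_length big_cons.
elim: s x => [|y s IH] x /=; first by rewrite big_seq1 big_nil addr0.
move=> /and3P[wx wy ws]; case: ifPn => [sxy|sxy].
  by rewrite !big_cons; have /= := IH x; rewrite wx => /(_ ws); lra.
apply: (le_trans (IH _ _)) => /=.
  rewrite ws andbT /wf_itv/= ge_min !le_max.
  by apply/orP; left; apply/orP; left.
rewrite big_cons; move: sxy wx wy; rewrite /sep /wf_itv negb_or -!ltNge.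
by move=> /andP[]; case: (leP x.1 y.1); case: (leP x.2 y.2); lra.
Qed.

Lemma merge_itv_cover x s z : has (fun p => p.1 < z <= p.2) (x :: s) ->
  has (fun p => p.1 < z <= p.2) (merge_itv x s).
Proof.
elim: s x => [|y s IH] x //= zxys; case: ifPn => _ /=.
  by case/or3P: zxys => [zx|->//|zs]; apply/orP; right; apply: IH;
    rewrite /= ?zx ?zs ?orbT.
apply: IH => /=; case/or3P : zxys => [/andP[h1 h2]|/andP[h1 h2]|->];
  by rewrite ?orbT// gt_min le_max ?h1 ?h2 ?orbT.
Qed.

Definition merge_itvs s := foldr merge_itv [::] s.

(** Covers supplied by Lebesgue outer measure may overlap, whereas absolute continuity speaks of
    separated intervals only. Merging passes from the former to the latter without increasing the
    total length. *)
Lemma merge_itvsP s : all wf_itv s -> [/\ all wf_itv (merge_itvs s),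
  pairwise sep (merge_itvs s), total_length (merge_itvs s) <= total_length s &
  forall z, has (fun p => p.1 < z <= p.2) s ->
    has (fun p => p.1 < z <= p.2) (merge_itvs s)].
Proof.
elim: s => [|x s IH] //= /andP[wx ws]; have [w ss l c] := IH ws.
split; [by apply: merge_itv_wf; rewrite /= wx|by apply: merge_itv_pairwise; rewrite //= wx| |].
  apply: (le_trans (total_length_merge_itv _)); first by rewrite /= wx.
  by rewrite /total_length !big_cons lerD2l.
move=> z zxs; apply: merge_itv_cover => /=.
by case/orP: zxs => [->//|/c->]; rewrite orbT.
Qed.

End IntervalLists.

(** * Total variation of absolutely continuous functions *)

Section TotalVariation.
Context {K : realType}.
Implicit Types (a b e : K) (f : K -> K) (s t : seq (K * K)).
Notation TV := total_variation.

Definition steps a (u : seq K) := zip (a :: u) u.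

Lemma steps_within a b u : itv_partition a b u -> all (within a b) (steps a u).
Proof.
elim: u a => [|c u IH] a //= abu.
have bc := itv_partition_cons abu.
have ac : a < c by move: abu => [/= /andP[]].
rewrite /within/= lexx (ltW ac) (itv_partition_le bc)/=.
apply: sub_all (IH c bc) => p /and3P[h1 h2 h3].
by apply/and3P; split=> //; rewrite (le_trans (ltW ac)).
Qed.

Lemma steps_pairwise a b u : itv_partition a b u -> pairwise sep (steps a u).
Proof.
elim: u a => [|c u IH] a //= abu; have bc := itv_partition_cons abu.
rewrite IH// andbT; apply: sub_all (steps_within bc) => p /and3P[h _ _].
by rewrite /sep/= h.
Qed.

Lemma total_length_steps a b u : itv_partition a b u ->
  total_length (steps a u) = b - a.
Proof.
rewrite /total_length; elim: u a => [|c u IH] a //= abu.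
  by rewrite big_nil (itv_partition_nil abu) subrr.
by rewrite big_cons/= (IH c (itv_partition_cons abu)); ring.
Qed.

Lemma variation_steps a b f u : itv_partition a b u ->
  variation a b f u = \sum_(p <- steps a u) `|f p.2 - f p.1|.
Proof.
elim: u a => [|c u IH] a abu; first by rewrite variation_nil big_nil.
rewrite /= big_cons -(IH c (itv_partition_cons abu)) /variation/=.
by rewrite big_nat_recl.
Qed.

Lemma steps_sep a b q u : itv_partition a b u -> sep (a, b) q ->
  all (sep q) (steps a u).
Proof.
move=> abu sq; apply: sub_all (steps_within abu) => p /and3P[h1 h2 h3].
by move: sq; rewrite /sep /= => /orP[] ?; apply/orP; [right|left]; lra.
Qed.

(** Replacing each interval by a partition of it keeps the family separated and preserves its total
    length, so the [d] that serves for [f] serves for its variation. The suprema over partitions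
    turn the strict bound into a weak one. *)
Lemma absolutely_continuous_total_variation a b f :
  absolutely_continuous a b f -> forall e, 0 < e -> exists2 d : K, 0 < d &
  forall s, all (within a b) s -> pairwise sep s -> total_length s < d ->
  (\sum_(p <- s) TV p.1 p.2 f <= e%:E)%E.
Proof.
move=> /absolutely_continuous_seq acf e e0; have [d d0 fd] := acf e e0.
exists d => // s sab ss sd.
(* The empty list is generalized to an accumulator [t], which collects the pieces of the intervals
   already partitioned; the induction trades one supremum at a time for a partition. *)
have : all (within a b) (s ++ [::]) by rewrite cats0.
have : pairwise sep (s ++ [::]) by rewrite cats0.
have : total_length (s ++ [::]) < d by rewrite cats0.
have E : 0%E = (\sum_(p <- ([::] : seq (K * K))) `|f p.2 - f p.1|)%:E.
  by rewrite big_nil.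
rewrite -[X in (X <= _)%E]adde0 [X in (_ + X)%E]E {E}.
elim: s [::] {sab ss sd} => [|p s IH] t /= std sst abst.
  by rewrite big_nil add0e lee_fin ltW// fd.
have step u : itv_partition p.1 p.2 u -> ((variation p.1 p.2 f u)%:E +
  (\sum_(q <- s) TV q.1 q.2 f + (\sum_(q <- t) `|f q.2 - f q.1|)%:E) <= e%:E)%E.
  move=> pu; rewrite (variation_steps _ pu).
  rewrite addeCA -EFinD -big_cat/=.
  move: abst; rewrite all_cat => /and3P[/and3P[pa pp pb] sab tab].
  move: sst; rewrite all_cat pairwise_cat => /andP[/andP[ps pt] /and3P[hst hs ht]].
  apply: IH.
  - move: std; rewrite /total_length big_cons !big_cat/=.
    have := total_length_steps pu; rewrite /total_length => -> ; lra.
  - rewrite pairwise_cat hs pairwise_cat ht (steps_pairwise pu) !andbT/=.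
    apply/andP; split.
      rewrite allrel_catr hst andbT.
      rewrite /allrel; apply: sub_all ps => q pq; apply: (steps_sep pu).
      by rewrite -surjective_pairing.
    rewrite allrelC; apply: sub_all pt => q pq.
    apply: sub_all (steps_sep pu (q := q) _) => [r|]; first by rewrite /sep orbC.
    by rewrite -surjective_pairing.
  - rewrite !all_cat sab tab andbT/=; apply: sub_all (steps_within pu).
    move=> q /and3P[h1 h2 h3]; apply/and3P; split => //.
      exact: le_trans h1.
    exact: le_trans h3 _.
have [st0 stf] : (0 <= \sum_(q <- s) TV q.1 q.2 f)%E /\
    (\sum_(q <- s) TV q.1 q.2 f + (\sum_(q <- t) `|f q.2 - f q.1|)%:E <= e%:E)%E.
  move: (abst); rewrite all_cat => /and3P[/and3P[_ pp _] sab tab].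
  split.
    rewrite big_seq; apply: sume_ge0 => q qs; apply: total_variation_ge0.
    by move/allP : sab => /(_ _ qs) /and3P[].
  apply: IH => //; last by rewrite all_cat sab.
  - by move: std; rewrite /total_length big_cons; lra.
  - by move: sst => /andP[].
rewrite big_cons -addeA.
set c := (\sum_(q <- s) TV q.1 q.2 f + (\sum_(q <- t) `|f q.2 - f q.1|)%:E)%E
  in stf step *.
(* Being finite, the remainder can change sides before the supremum over partitions is taken. *)
have cfin : c \is a fin_num.
  rewrite ge0_fin_numE; first exact: le_lt_trans stf (ltry _).
  by rewrite adde_ge0// lee_fin; exact: sumr_ge0.
rewrite -leeBrDr//; apply: ge_ereal_sup => _ [_ [u pu <-] <-].
by rewrite leeBrDr// step.
Qed.

Lemma absolutely_continuous_bounded_variation a b f : a <= b ->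
  absolutely_continuous a b f -> TV a b f \is a fin_num.
Proof.
move=> ab /absolutely_continuous_total_variation /(_ 1 ltr01)[d d0 fd].
(* Enough equal pieces for each to be shorter than [d], hence of variation at most 1; the induction
   below adds them one by one. *)
pose n := (Num.truncn ((b - a) / d)).+1.
pose h := (b - a) / n%:R.
have n0 : 0 < n%:R :> K by rewrite ltr0n.
have hd : h < d.
  by rewrite /h ltr_pdivrMr// mulrC -ltr_pdivrMr// /n truncnS_gt.
have h0 : 0 <= h by rewrite /h divr_ge0 ?subr_ge0// ltW.
have : (n <= n)%N by []. 
have -> : b = a + h * n%:R by rewrite /h divfK ?gt_eqF//; ring.
move: {1 3}n => m; elim: m => [|m IH] mn.
  by rewrite mulr0 addr0 total_variationxx.
have h1 : a <= a + h * m%:R by rewrite lerDl mulr_ge0.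
have h2 : a + h * m%:R <= a + h * m.+1%:R by rewrite lerD2l ler_wpM2l// ler_nat.
rewrite (total_variationD _ h1 h2) fin_numD IH ?(ltnW mn)//=.
have := fd [:: (a + h * m%:R, a + h * m.+1%:R)]; rewrite /total_length !big_seq1/=.
rewrite -natr1; move=> /(_ _ isT) H.
rewrite ge0_fin_numE; last by apply: total_variation_ge0; lra.
apply: le_lt_trans (H _ _) (ltry _); last by lra.
rewrite /within/= h1 natr1 h2 andbT/=.
rewrite (_ : b = a + h * n%:R); last by rewrite /h divfK ?gt_eqF//; ring.
by rewrite lerD2l ler_wpM2l// ler_nat.
Qed.

End TotalVariation.

(** * Densities of absolutely continuous functions *)

Section StieltjesDomination.
Context {K : realType}.
Variable g : cumulative K K.
Notation mu := (@lebesgue_measure K).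
Notation nu := (lebesgue_stieltjes_measure g).

Lemma lebesgue_stieltjes_measure_itvoc (c d : K) : c <= d ->
  nu `]c, d] = (g d - g c)%:E.
Proof.
move=> cd; rewrite /lebesgue_stieltjes_measure /measure_extension.
rewrite measurable_mu_extE/=; last exact: is_ocitv.
by rewrite wlength_itv_bnd.
Qed.

Hypothesis g_ac : forall e : K, 0 < e -> exists2 d : K, 0 < d &
  forall s : seq (K * K), all (@wf_itv K) s -> pairwise sep s -> total_length s < d ->
  \sum_(p <- s) (g p.2 - g p.1) <= e.

Lemma stieltjes_cover_le (s : seq (K * K)) (A : set K) : all (@wf_itv K) s ->
  measurable A -> (forall z, A z -> has (fun p => p.1 < z <= p.2) s) ->
  (nu A <= (\sum_(p <- s) (g p.2 - g p.1))%:E)%E.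
Proof.
elim: s A => [|p s IH] A /=.
  move=> _ mA A0; rewrite big_nil (_ : A = set0) ?measure0//.
  by apply/seteqP; split => // z /A0.
move=> /andP[wp ws] mA Aps; rewrite big_cons EFinD.
pose I : set K := `]p.1, p.2]%classic.
have mI : measurable I by exact: measurable_itv.
have -> : (g p.2 - g p.1)%:E = nu I by rewrite -lebesgue_stieltjes_measure_itvoc.
apply: (@le_trans _ _ (nu (I `|` (A `\` I)))).
  apply: le_measure; rewrite ?inE//.
    by apply: measurableU => //; exact: measurableD.
  by move=> z Az; have [zp|zp] := pselect (I z); [left|right].
apply: (le_trans (measureU2 _ _ _)) => //; first exact: measurableD.
apply: leeD => //; apply: IH => //; first exact: measurableD.
move=> z [/Aps/orP[zp|//]] /=.
by rewrite /I/= in_itv/= zp.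
Qed.

(** A null set has a countable cover by half-open intervals of total length below [d]. Each finite
    part of the cover, once merged, has Stieltjes measure at most [e]. *)
Lemma stieltjes_null (A : set K) : measurable A -> mu A = 0%E -> nu A = 0%E.
Proof.
move=> mA A0; apply/eqP; rewrite eq_le measure_ge0 andbT.
apply/lee_addgt0Pr => e e0; rewrite add0e.
have [d d0 gd] := g_ac e0.
have : (mu A < d%:E)%E by rewrite A0 lte_fin.
move=> /ereal_inf_lt[_ [F [mF AF] <-] Fd].
have /choice[lr lrE] (n : nat) : exists p : K * K, wf_itv p /\ F n = `]p.1, p.2]%classic.
  have /ocitvP[->|[x x12 ->]] := mF n.
    exists (0, 0); split; first by rewrite /wf_itv.
    by rewrite set_itvoc0.
  by exists x; split; [exact: ltW|].
pose F' : nat -> set (measurableTypeR K) := F.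
have mF' n : measurable (F' n) by rewrite /F' (lrE n).2; exact: measurable_itv.
(* Continuity from below reduces the countable cover to finite ones. *)
have cvgF : nu (\big[setU/set0]_(i < n.+1) F' i) @[n --> \oo] --> nu (\bigcup_n F' n).
  rewrite -bigcup_bigsetU_bigcup; 
  apply: (@nondecreasing_cvg_mu _ _ _ nu (fun n => \big[setU/set0]_(i < n.+1) F' i)).
  - by move=> n; apply: bigsetU_measurable.
  - by apply: bigcup_measurable => n _; apply: bigsetU_measurable.
  - by apply/nondecreasing_seqP => n; apply/subsetPset => z;
      rewrite -!bigcup_mkord => -[i /= ni Fi]; exists i => //=; exact: ltnW.
apply: (@le_trans _ _ (nu (\bigcup_n F' n))).
  by apply: le_measure; rewrite ?inE//; exact: bigcup_measurable.
rewrite -(cvg_lim _ cvgF)//; apply: lime_le; first by apply/cvg_ex; eexists; exact: cvgF.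
apply: nearW => n; move: n.+1 => {}n.
pose s := [seq lr i | i <- iota 0 n].
have ws : all (@wf_itv K) s by apply/allP => _ /mapP[i _ ->]; exact: (lrE i).1.
have [ws' ss' ls' cs'] := merge_itvsP ws.
have mU : measurable (\big[setU/set0]_(i < n) F' i).
  by apply: bigsetU_measurable.
apply: (le_trans (stieltjes_cover_le ws' mU _)).
- move=> z; rewrite -bigcup_mkord => -[i /= ni]; rewrite /F' => Fi; apply: cs'.
  apply/hasP; exists (lr i); first by apply: map_f; rewrite mem_iota.
  by move: Fi; rewrite (lrE i).2 /= in_itv.
rewrite lee_fin; apply: gd => //; apply: (le_lt_trans ls').
rewrite -lte_fin; apply: le_lt_trans Fd.
rewrite /total_length big_map -{1}(subn0 n) -/(index_iota 0 n) big_mkord -sumEFin.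
rewrite (eq_bigr (fun i : 'I_n => wlength idfun (F i))); last first.
  by move=> i _; rewrite (lrE i).2 wlength_itv_bnd//; exact: (lrE i).1.
rewrite -(big_mkord xpredT (fun i => wlength idfun (F i))).
apply: nneseries_lim_ge => i _ _; rewrite (lrE i).2.
exact: wlength_itv_ge0.
Qed.

End StieltjesDomination.

(** * Radon-Nikodym densities of Stieltjes measures *)

Section StieltjesDensity.
Context {K : realType}.
Notation mu := (@lebesgue_measure K).

(** Both halves of the fundamental theorem of calculus. Being integrable, [rho] is a measurable
    substitute for [derive1 f], with which it agrees almost everywhere on []a, b[]. *)
Definition density (a b : K) (f rho : K -> K) :=
  [/\ mu.-integrable setT (EFin \o rho),
    forall c d, a <= c -> c <= d -> d <= b ->
      f d - f c = \int[mu]_(x in `]c, d]) rho x &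
    {ae mu, forall x, x \in `]a, b[ -> is_derive x 1 f (rho x)}].

Lemma stieltjes_density (g : cumulative K K) (a b : K) : a <= b ->
  (forall e : K, 0 < e -> exists2 d : K, 0 < d &
  forall s : seq (K * K), all (@wf_itv K) s -> pairwise sep s -> total_length s < d ->
  \sum_(p <- s) (g p.2 - g p.1) <= e) ->
  exists rho, density a b g rho.
Proof.
move=> ab g_ac.
pose D : set (measurableTypeR K) := `]a, b]%classic.
have mD : measurable D by exact: measurable_itv.
have Dfin : (lebesgue_stieltjes_measure g D < +oo)%E.
  by rewrite /D lebesgue_stieltjes_measure_itvoc// ltry.
pose nu : {finite_measure set (measurableTypeR K) -> \bar K} := mfrestr mD Dfin.
have nuE c d : a <= c -> c <= d -> d <= b -> nu `]c, d]%classic = (g d - g c)%:E.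
  move=> ac cd db; rewrite /nu/= /mfrestr /mrestr/=.
  rewrite setIidl ?lebesgue_stieltjes_measure_itvoc//.
  by apply: subset_itv; rewrite bnd_simp.
have numu : nu `<< mu.
  apply/null_content_dominatesP => A mA A0; rewrite /nu/= /mfrestr /mrestr/=.
  apply: stieltjes_null => //; first exact: measurableI.
  apply/eqP; rewrite eq_le measure_ge0 andbT -A0; apply: le_measure; rewrite ?inE//.
  exact: measurableI.
have [f [f0 ffin fint fE]] := radon_nikodym_sigma_finite numu.
pose rho : K -> K := fun x => fine (f x).
have rhoE : EFin \o rho = f by apply/funext => x /=; rewrite /rho fineK.
have rhoi : mu.-integrable setT (EFin \o rho) by rewrite rhoE.
have rhoI A : measurable A -> \int[mu]_(x in A) rho x = fine (nu A).
  by move=> mA; rewrite /Rintegral fE// -rhoE.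
exists rho; split => //.
  by move=> c d ac cd db; rewrite rhoI ?nuE.
pose F (y : K) : K := \int[mu]_(t in [set` `]-oo, y]]) rho t.
have : {ae mu, forall x, derivable F x 1 /\ derive1 F x = rho x}.
  apply: FTC1Ny.
    by move=> y; apply: integrableS rhoi.
  exact: (open_integrable_locally openT).
apply: filterS; first exact: (ae_filter_ringOfSetsType mu).
move=> x [dx dxE]; rewrite in_itv/= => /andP[ax xb].
(* The measure is confined to []a, b]], so the primitive from minus infinity is the increment of [g]
   from [a]. *)
have nE : \forall y \near x, F y = g y - g a.
  near=> y.
  have ay : a < y by near: y; exact: lt_nbhsr.
  have yb : y < b by near: y; exact: lt_nbhsl.
  rewrite /F rhoI// /nu/= /mfrestr /mrestr/= /D.
  rewrite (_ : `]-oo, y] `&` `]a, b] = `]a, y])%classic.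
    by rewrite lebesgue_stieltjes_measure_itvoc// ltW.
  apply/seteqP; split => z /=; rewrite !in_itv/=; first by move=> [-> /andP[->]].
  by move=> /andP[-> zy]; split => //; rewrite (le_trans zy) ?ltW.
have : is_derive x 1 F (rho x).
  by apply: DeriveDef; [exact: dx|rewrite -derive1E; exact: dxE].
move=> H.
have : is_derive x 1 (fun y => g y - g a) (rho x).
  by apply: near_eq_is_derive nE H; rewrite oner_neq0.
move=> {}H.
have -> : (g : K -> K) = (fun y => g y - g a) + cst (g a).
  by apply/funext => y /=; rewrite subrK.
by rewrite -[rho x]addr0; apply: is_deriveD.
Unshelve. all: by end_near. Qed.

End StieltjesDensity.

(** * From monotone to arbitrary absolutely continuous functions *)

Section AbsolutelyContinuousDensity.
Context {K : realType}.
Notation mu := (@lebesgue_measure K).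
Notation TV := total_variation.

Definition clamp (a b x : K) := Num.max a (Num.min b x).

Lemma clamp_id (a b x : K) : a <= x <= b -> clamp a b x = x.
Proof. by move=> /andP[ax xb]; rewrite /clamp (min_idPr xb) (max_idPr ax). Qed.

Lemma clamp_itv (a b x : K) : a <= b -> a <= clamp a b x <= b.
Proof. by move=> ab; rewrite /clamp le_max lexx/= ge_max ab ge_min lexx. Qed.

Lemma clamp_dist (a b x y : K) : a <= b -> x <= y ->
  0 <= clamp a b y - clamp a b x <= y - x.
Proof.
rewrite /clamp => ab xy; apply/andP.
case: (leP b x) => ?; case: (leP b y) => ?; case: (leP a x) => ?;
  case: (leP a y) => ?; case: (leP a b) => ?; split; lra.
Qed.

Lemma clamp_homo (a b x y : K) : a <= b -> x <= y -> clamp a b x <= clamp a b y.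
Proof. by move=> ab xy; rewrite -subr_ge0; have /andP[] := clamp_dist ab xy. Qed.

Lemma density_congr (a b : K) (f g rho : K -> K) :
  (forall x, a <= x <= b -> f x = g x) -> density a b f rho -> density a b g rho.
Proof.
move=> fg [rhoi rhoE rhod]; split => //.
  by move=> c d ac cd db; rewrite -!fg ?rhoE//; lra.
move: rhod; apply: filterS; first exact: (ae_filter_ringOfSetsType mu).
move=> x rhox xab; apply: near_eq_is_derive (rhox xab); rewrite ?oner_neq0//.
move: xab; rewrite in_itv/= => /andP[ax xb]; near=> y; rewrite fg//.
apply/andP; split; apply: ltW.
  by near: y; exact: lt_nbhsr.
by near: y; exact: lt_nbhsl.
Unshelve. all: by end_near. Qed.

Lemma densityB (a b : K) (f g r s : K -> K) : density a b f r ->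
  density a b g s -> density a b (f \- g) (r \- s).
Proof.
move=> [ri rE rd] [si sE sd]; split.
- by rewrite (_ : _ \o _ = (EFin \o r) \- (EFin \o s))%E//; exact: integrableB.
- move=> c d ac cd db; rewrite RintegralB//; [|exact: integrableS ri|exact: integrableS si].
  by rewrite -rE// -sE//=; ring.
- have aeF : Filter (almost_everywhere mu) by exact: (ae_filter_ringOfSetsType mu).
  apply: filterS2 rd sd => x rx sx xab.
  by apply: is_deriveB; [exact: rx|exact: sx].
Qed.

(** Composition with [clamp] extends [f] by constants to a cumulative function on the whole line;
    absolute continuity survives because [clamp] is nondecreasing and 1-Lipschitz. *)
Lemma nondecreasing_density (a b : K) (f : K -> K) : a < b ->
  {in `[a, b] &, {homo f : x y / x <= y}} ->
  (forall e : K, 0 < e -> exists2 d : K, 0 < d &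
    forall s, all (within a b) s -> pairwise sep s -> total_length s < d ->
    \sum_(p <- s) (f p.2 - f p.1) <= e) ->
  exists rho, density a b f rho.
Proof.
move=> ab ndf acf; have leab := ltW ab.
pose g (x : K) : K := f (clamp a b x).
have gnd : {homo g : x y / x <= y}.
  by move=> x y xy; apply: ndf; rewrite ?in_itv/= ?clamp_itv ?clamp_homo.
have gac (e : K) : 0 < e -> exists2 d : K, 0 < d &
    forall s : seq (K * K), all (@wf_itv K) s -> pairwise sep s ->
    total_length s < d -> \sum_(p <- s) (g p.2 - g p.1) <= e.
  move=> /acf[d d0 fd]; exists d => // s ws ss sd.
  have := fd [seq (clamp a b p.1, clamp a b p.2) | p <- s].
  rewrite /total_length !big_map/=; apply.
  - rewrite all_map; apply: sub_all ws => p wp /=.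
    by rewrite /within/= clamp_homo//; have := clamp_itv p.1 leab;
      have := clamp_itv p.2 leab => /andP[_ ->] /andP[-> _].
  - rewrite pairwise_map; apply: sub_pairwise ss => p q; rewrite /sep/=.
    by move=> /orP[] /(clamp_homo leab) ->; rewrite ?orbT.
  - apply: le_lt_trans sd; rewrite /total_length big_seq [leRHS]big_seq.
    by apply: ler_sum => p ps; have /andP[] := clamp_dist leab (allP ws p ps).
have grc : right_continuous g.
  move=> x; apply/cvgrPdist_lt => e e0; have [d d0 gd] := gac (e / 2) (divr_gt0 e0 (ltr0Sn _ 1)).
  near=> y; have xy : x < y by near: y; exact: nbhs_right_gt.
  rewrite distrC ger0_norm ?subr_ge0 ?gnd ?ltW//.
  have := gd [:: (x, y)]; rewrite /total_length !big_seq1/= /wf_itv/= (ltW xy).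
  have yxd : y - x < d by rewrite ltrBlDl; near: y; apply: nbhs_right_lt; rewrite ltrDl.
  by move=> /(_ isT isT yxd); lra.
pose G : cumulative K K := HB.pack g (isCumulative.Build K _ K g gnd grc).
have [rho H] := @stieltjes_density K G a b leab gac.
exists rho; apply: density_congr H => x xab.
by rewrite /G/= /g clamp_id.
Unshelve. all: by end_near. Qed.

(** The variation [V] dominates the increments of [f], so [V] and [V \- f] are both nondecreasing,
    and [f] is their difference. *)
Lemma absolutely_continuous_density (a b : K) (f : K -> K) : a < b ->
  absolutely_continuous a b f -> exists rho, density a b f rho.
Proof.
move=> ab acf; have leab := ltW ab.
have TVfin c d : a <= c -> c <= d -> d <= b -> TV c d f \is a fin_num.
  move=> ac cd db; have := absolutely_continuous_bounded_variation leab acf.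
  rewrite (total_variationD _ (le_trans ac cd) db) (total_variationD _ ac cd).
  by rewrite !fin_numD => /andP[/andP[]].
pose V (x : K) : K := fine (TV a x f).
have VB x y : a <= x -> x <= y -> y <= b -> V y - V x = fine (TV x y f).
  move=> ax xy yb; rewrite /V (total_variationD _ ax xy) fineD ?TVfin//.
  - by rewrite addrAC subrr add0r.
  - exact: le_trans xy yb.
have Vf x y : a <= x -> x <= y -> y <= b -> `|f y - f x| <= V y - V x.
  move=> ax xy yb; rewrite VB// -lee_fin fineK ?TVfin//.
  exact: total_variation_ge.
have Vac (e : K) : 0 < e -> exists2 d : K, 0 < d &
    forall s, all (within a b) s -> pairwise sep s -> total_length s < d ->
    \sum_(p <- s) (V p.2 - V p.1) <= e.
  move=> /(absolutely_continuous_total_variation acf)[d d0 fd]; exists d => // s sab ss sd.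
  rewrite -lee_fin; apply: le_trans (fd s sab ss sd).
  rewrite -sumEFin big_seq [leRHS]big_seq; apply: lee_sum => p ps.
  by have /and3P[h1 h2 h3] := allP sab p ps; rewrite VB// fineK ?TVfin.
have [r Vr] : exists r, density a b V r.
  apply: nondecreasing_density => // x y; rewrite !in_itv/= => /andP[ax xb] /andP[ay yb] xy.
  by rewrite -subr_ge0; apply: le_trans (Vf _ _ ax xy yb).
have [s Ws] : exists s, density a b (V \- f) s.
  apply: nondecreasing_density => //.
    move=> x y; rewrite !in_itv/= => /andP[ax xb] /andP[ay yb] xy.
    by have := Vf _ _ ax xy yb; have := ler_norm (f y - f x); lra.
  (* Half of [e], since the increments of [V \- f] are at most twice those of [V]. *)
  move=> e e0; have [|d d0 Vd] := Vac (e / 2); first by rewrite divr_gt0.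
  exists d => // t tab tt td; have := Vd t tab tt td.
  rewrite ler_pdivlMr// mulrC; apply: le_trans.
  rewrite mulr_sumr big_seq [leRHS]big_seq; apply: ler_sum => p pt /=.
  have /and3P[h1 h2 h3] := allP tab p pt; have := Vf _ _ h1 h2 h3.
  by have := ler_norm (- (f p.2 - f p.1)); rewrite normrN; lra.
exists (r \- s); apply: density_congr (densityB Vr Ws) => x _ /=.
by rewrite opprB addrC subrK.
Qed.

End AbsolutelyContinuousDensity.

(** * Lower bounds for integrals of possibly nonmeasurable functions *)

Section LowerIntegral.
Context d (T : measurableType d) (K : realType).
Variable mu : {measure set T -> \bar K}.

(* The integral of a nonnegative function is a supremum over the simple functions
   below it; hence plans whose derivative is not known to be Borel measurable can
   be handled. *)
Lemma ge0_le_integral_subset (D1 D2 : set T) (f1 f2 : T -> \bar K) :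
  D1 `<=` D2 -> (forall x, D1 x -> 0 <= f1 x)%E -> (forall x, D2 x -> 0 <= f2 x)%E ->
  (forall x, D1 x -> f1 x <= f2 x)%E ->
  (\int[mu]_(x in D1) f1 x <= \int[mu]_(x in D2) f2 x)%E.
Proof.
move=> D12 f10 f20 f12; rewrite !ge0_integralE//.
apply: le_ereal_sup => _ [h hf1 <-]; exists h => // x.
apply: le_trans (hf1 x) _; rewrite /patch.
case: ifPn => [/set_mem D1x|_]; last by case: ifPn => // /set_mem /f20.
by rewrite mem_set ?f12//; exact: D12.
Qed.

(** Away from the exceptional null set the positive part of [L] is a nonnegative function below [F],
    so monotonicity applies without measurability of [F]. *)
Lemma le_integral_lower (D : set T) (L : T -> K) (F : T -> \bar K) :
  measurable D -> mu.-integrable D (EFin \o L) ->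
  (forall x, D x -> 0 <= F x)%E -> {ae mu, forall x, D x -> ((L x)%:E <= F x)%E} ->
  ((\int[mu]_(x in D) L x)%:E <= \int[mu]_(x in D) F x)%E.
Proof.
move=> mD Li F0 [N [mN N0 DN]].
rewrite /Rintegral fineK; last exact: integrable_fin_num.
rewrite (negligible_integral mN)//.
have LDN : mu.-integrable (D `\` N) (EFin \o L).
  by apply: integrableS Li => //; exact: measurableD.
have mDN : measurable (D `\` N) by exact: measurableD.
apply: (@le_trans _ _ (\int[mu]_(x in D `\` N) ((EFin \o L)^\+ x))%E).
  apply: le_integral => //; first exact: integrable_funepos.
  by move=> x _; rewrite funeposE le_max lexx.
apply: ge0_le_integral_subset => //.
move=> x [Dx Nx]; rewrite funeposE ge_max F0// andbT.
by apply: contrapT => H; apply: Nx; apply: DN => /(_ Dx).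
Qed.

End LowerIntegral.

(** * Barriers for absolutely continuous functions *)

Section AbsolutelyContinuousTheory.
Context {K : realType}.
Implicit Types (a b c d : K) (f g : K -> K).
Notation mu := (@lebesgue_measure K).

Lemma absolutely_continuous_sub a b c d f : a <= c -> d <= b ->
  absolutely_continuous a b f -> absolutely_continuous c d f.
Proof.
move=> ac db acf e e0; have [r r0 fr] := acf e e0; exists r => // n l u lu.
by apply: fr => i; have [h1 h2 h3] := lu i; split; lra.
Qed.

Lemma absolutely_continuousB a b f g : absolutely_continuous a b f ->
  absolutely_continuous a b g -> absolutely_continuous a b (f \- g).
Proof.
move=> acf acg e e0; have e20 : 0 < e / 2 by lra.
have [r r0 fr] := acf _ e20; have [s s0 gs] := acg _ e20.
exists (Num.min r s); first by rewrite lt_min r0.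
move=> n l u lu dlu; rewrite lt_min => /andP[lur lus].
have := fr n l u lu dlu lur; have := gs n l u lu dlu lus.
set A := (X in X < _ -> _); set B := (X in _ -> X < _ -> _) => Ae Be.
apply: (@le_lt_trans _ _ (B + A)); last by lra.
rewrite -big_split/=; apply: ler_sum => i _.
have -> : (f \- g) (u i) - (f \- g) (l i) = f (u i) - f (l i) - (g (u i) - g (l i)).
  by rewrite /=; ring.
exact: ler_normB.
Qed.

Lemma lipschitz_absolutely_continuous a b f (M : K) :
  (forall x y, a <= x -> x <= y -> y <= b -> `|f y - f x| <= M * (y - x)) ->
  absolutely_continuous a b f.
Proof.
move=> fM e e0; exists (e / (`|M| + 1)); first by rewrite divr_gt0// ltr_wpDl.
move=> n l u lu _; rewrite ltr_pdivlMr ?ltr_wpDl//; apply: le_lt_trans.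
rewrite mulr_suml; apply: ler_sum => i _; have [h1 h2 h3] := lu i.
apply: le_trans (fM _ _ h1 h2 h3) _; rewrite mulrC ler_wpM2l ?subr_ge0//.
by apply: le_trans (ler_norm M) _; rewrite lerDl.
Qed.

Lemma absolutely_continuous_uniform a b f : absolutely_continuous a b f ->
  forall e : K, 0 < e -> exists2 r : K, 0 < r &
    forall x y, a <= x -> x <= y -> y <= b -> y - x < r -> `|f y - f x| < e.
Proof.
move=> /absolutely_continuous_seq acf e /acf[r r0 fr]; exists r => // x y ax xy yb.
have := fr [:: (x, y)]; rewrite /total_length !big_seq1/= /within/= ax xy yb.
exact.
Qed.

(** The increment is the integral of the density, which equals the derivative almost everywhere. For
    merely continuous functions this fails, as the Cantor function shows. *)
Lemma absolutely_continuous_le a b f : a <= b -> absolutely_continuous a b f ->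
  {ae mu, forall x, x \in `]a, b[ -> exists2 v, v <= 0 & is_derive x 1 f v} ->
  f b <= f a.
Proof.
rewrite le_eqVlt => /predU1P[->//|ab] acf aef.
have [rho [rhoi rhoE rhod]] := absolutely_continuous_density ab acf.
rewrite -subr_le0 rhoE ?(ltW ab)//.
have mab : measurable (`]a, b[ : set K) by exact: measurable_itv.
rewrite -Rintegral_itv_bndo_bndc; last exact: integrableS rhoi.
have irho : mu.-integrable `]a, b[ (EFin \o rho) by exact: integrableS rhoi.
suff : ((\int[mu]_(x in `]a, b[) rho x)%:E <= 0)%E by rewrite lee_fin.
have -> : 0%E = (\int[mu]_(x in `]a, b[) (0 : \bar K))%E by rewrite integral0.
apply: le_integral_lower => //.
have aeF : Filter (almost_everywhere mu) by exact: (ae_filter_ringOfSetsType mu).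
apply: filterS2 aef rhod => x fx rhox xab.
have [v v0 fv] := fx xab; have := rhox xab => frho.
by rewrite lee_fin -(@derive_val _ _ _ _ _ _ _ frho) (@derive_val _ _ _ _ _ _ _ fv).
Qed.

(* Just after the last exit from [h <= 0], continuity keeps [h] below [delta]. *)
Lemma absolutely_continuous_barrier a b (h : K -> K) (delta : K) :
  absolutely_continuous a b h -> h a <= 0 -> 0 < delta ->
  {ae mu, forall x, x \in `]a, b[ -> 0 < h x < delta ->
    exists2 v, v <= 0 & is_derive x 1 h v} ->
  forall t, a <= t <= b -> h t <= 0.
Proof.
move=> ach ha delta0 aeh t /andP[at_ tb]; rewrite leNgt; apply/negP => ht.
pose S := [set s | a <= s <= t /\ h s <= 0].
have Sa : S a by split => //; rewrite lexx.
have Sub : has_ubound S by exists t => s [/andP[]].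
have Ssup : has_sup S by split; [exists a|].
pose s0 := sup S.
have as0 : a <= s0 by exact: ub_le_sup.
have s0t : s0 <= t by apply: ge_sup; [exists a|move=> s [/andP[]]].
have hs0 : h s0 <= 0.
  rewrite leNgt; apply/negP => hs0.
  have [r r0 hr] := absolutely_continuous_uniform ach hs0.
  have [s [/andP[as_ st] hs] ss0] := sup_adherent r0 Ssup.
  have sles0 : s <= s0 by apply: ub_le_sup => //; split => //; rewrite as_ st.
  have := hr s s0 as_ sles0 (le_trans s0t tb).
  by rewrite -/s0 in ss0; have := ler_norm (h s0 - h s); lra.
have s0ltt : s0 < t by rewrite lt_neqAle s0t andbT; apply/eqP => E; rewrite E in hs0; lra.
have hgt s : s0 < s -> s <= t -> 0 < h s.
  move=> s0s st; rewrite ltNge; apply/negP => hs.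
  suff : s <= s0 by lra.
  by apply: ub_le_sup => //; split => //; rewrite st andbT; lra.
have [r r0 hr] := absolutely_continuous_uniform ach delta0.
pose t3 := Num.min t (s0 + r / 2).
have [s0t3 t3t t3r] : [/\ s0 < t3, t3 <= t & t3 <= s0 + r / 2].
  rewrite /t3; case: (leP t (s0 + r / 2)) => ?; split; lra.
have : h t3 <= h s0.
  apply: absolutely_continuous_le; first exact: ltW.
    by apply: absolutely_continuous_sub ach => //; lra.
  have aeF : Filter (almost_everywhere mu) by exact: (ae_filter_ringOfSetsType mu).
  apply: filterS aeh => x hx; rewrite in_itv/= => /andP[s0x xt3].
  apply: hx; first by rewrite in_itv/=; apply/andP; split; lra.
  rewrite hgt//=; last by lra.
  have := hr s0 x as0 (ltW s0x); have := ler_norm (h x - h s0); lra.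
by have := hgt t3 s0t3 t3t; lra.
Qed.

End AbsolutelyContinuousTheory.

(** * Calculus *)

Section RealCalculus.
Context {K : realType}.
Implicit Types (a b : K) (f df : K -> K).

Lemma is_derive_within_continuous a b f df :
  (forall x, a <= x <= b -> is_derive x 1 f (df x)) ->
  {within `[a, b], continuous f}.
Proof.
move=> fdf; apply: derivable_within_continuous => x; rewrite in_itv/= => xab.
by have [] := fdf x xab.
Qed.

Lemma is_derive_mean_value a b f df : a <= b ->
  (forall x, a <= x <= b -> is_derive x 1 f (df x)) ->
  exists2 c, a <= c <= b & f b - f a = df c * (b - a).
Proof.
move=> ab fdf.
have fdf' x : x \in `]a, b[ -> is_derive x 1 f (df x).
  by rewrite in_itv/= => /andP[ax xb]; apply: fdf; rewrite !ltW.
have [c] := MVT_segment ab fdf' (is_derive_within_continuous fdf).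
by rewrite in_itv/= => cab E; exists c.
Qed.

Lemma is_derive_ge0_le a b f df : a <= b ->
  (forall x, a <= x <= b -> is_derive x 1 f (df x)) ->
  (forall x, a <= x <= b -> 0 <= df x) -> f a <= f b.
Proof.
move=> ab fdf df0; have [c cab E] := is_derive_mean_value ab fdf.
by rewrite -subr_ge0 E mulr_ge0 ?df0// subr_ge0.
Qed.

Lemma is_derive_le0_le a b f df : a <= b ->
  (forall x, a <= x <= b -> is_derive x 1 f (df x)) ->
  (forall x, a <= x <= b -> df x <= 0) -> f b <= f a.
Proof.
move=> ab fdf df0; have [c cab E] := is_derive_mean_value ab fdf.
by rewrite -subr_le0 E mulr_le0_ge0 ?df0// subr_ge0.
Qed.

Lemma is_derive_integral a b f df : a <= b ->
  (forall x, a <= x <= b -> is_derive x 1 f (df x)) ->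
  {within `[a, b], continuous df} ->
  (\int[@lebesgue_measure K]_(x in `[a, b]) (df x)%:E = (f b - f a)%:E)%E.
Proof.
rewrite le_eqVlt => /predU1P[-> fdf _|ab fdf cdf].
  by rewrite set_itv1 integral_set1 subrr.
have fdf' x : x \in `]a, b[ -> is_derive x 1 f (df x).
  by rewrite in_itv/= => /andP[ax xb]; apply: fdf; rewrite !ltW.
rewrite EFinB; apply: continuous_FTC2 => //.
  have /continuous_within_itvP /= := is_derive_within_continuous fdf.
  move=> /(_ ab)[? ? ?]; split => // x /fdf'[].
  by [].
by move=> x /fdf'; rewrite derive1E => -[].
Qed.

Lemma powR_gt1 (a r : K) : 1 < a -> 0 < r -> 1 < a `^ r.
Proof.
move=> a1 r0; have : 1 `^ r < a `^ r.
  by apply: gt0_ltr_powR; rewrite ?nnegrE// ltW// (lt_trans ltr01).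
by rewrite powR1.
Qed.

Lemma is_derive_powR_comp (r x b : K) (g : K -> K) : 0 < g x ->
  is_derive x 1 g b ->
  is_derive x 1 (fun y => g y `^ r) (r * g x `^ (r - 1) * b).
Proof.
move=> gx0 gb.
exact: (@is_derive1_comp _ (@powR K ^~ r) g x _ _ (is_derive1_powR r gx0) gb).
Qed.

(** The power function lies above its tangent at [p]. This is Young's inequality for [q] and the
    power [al - 1] of [p], with exponents [al] and [al / (al - 1)]. *)
Lemma young_powR (al p q : K) : 1 < al -> 0 <= p -> 0 <= q ->
  al * p `^ (al - 1) * q - (al - 1) * p `^ al <= q `^ al.
Proof.
move=> al1 p0 q0.
have al0 : al != 0 by apply: lt0r_neq0; lra.
have al10 : al - 1 != 0 by apply: lt0r_neq0; lra.
have := @conjugate_powR K q (p `^ (al - 1)) al (al / (al - 1)) q0 (powR_ge0 _ _).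
rewrite -powRrM (_ : (al - 1) * (al / (al - 1)) = al); last by field.
move=> /(_ _ _ _)/wrap[]; first lra.
  by apply: divr_gt0; lra.
  by field; rewrite al10 al0.
rewrite -(@ler_pM2l _ al); last lra.
rewrite (_ : al * (q `^ al / al + _) = q `^ al + (al - 1) * p `^ al); last first.
  by field; rewrite al10 al0.
by lra.
Qed.

Lemma young_powR_lt (al p q : K) : 1 < al -> 0 <= p -> p < q ->
  al * p `^ (al - 1) * q - (al - 1) * p `^ al < q `^ al.
Proof.
move=> al1; rewrite le_eqVlt => /predU1P[<- q0|p0 pq].
  (* At [p = 0] the tangent is the zero line and the claim is positivity; for [p > 0] the mean value
     theorem gives strictness. *)
  rewrite !powR0 ?mulr0 ?mul0r ?subrr ?powR_gt0//; apply: lt0r_neq0; lra.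
have dp x : x \in `]p, q[ -> is_derive x 1 (@powR K ^~ al) (al * x `^ (al - 1)).
  by rewrite in_itv/= => /andP[px xq]; apply: is_derive1_powR; lra.
have cp : {within `[p, q], continuous (@powR K ^~ al)}.
  apply: (@is_derive_within_continuous _ _ _ (fun x => al * x `^ (al - 1))).
  by move=> x /andP[px xq]; apply: is_derive1_powR; lra.
have [c] := MVT pq dp cp.
rewrite in_itv/= => /andP[pc cq] E.
have pE : p `^ al = p `^ (al - 1) * p by rewrite mulrC mulr_powRB1 ?ltW//; lra.
have : al * p `^ (al - 1) * (q - p) < q `^ al - p `^ al.
  rewrite E ltr_pM2r ?subr_gt0// ltr_pM2l; last lra.
  by rewrite gt0_ltr_powR// ?nnegrE; lra.
by rewrite pE; lra.
Qed.

End RealCalculus.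

(** * Cost of a plan *)

Section Effort.
Context {K : realType}.
Variables (al lam m : K).
Hypotheses (al1 : 1 < al) (lam0 : 0 < lam) (m0 : 0 < m).
Notation leb := (@lebesgue_measure K).

(** Raising [1 + lam * (s - t)] to the power [kappa - 1] gives the power -1 / (al - 1) of the
    discount factor. *)
Definition kappa : K := m / (lam * (al - 1)) + 1.

Let al10 : 0 < al - 1. Proof. by rewrite subr_gt0. Qed.

Lemma kappa_gt1 : 1 < kappa.
Proof. by rewrite /kappa ltrDr divr_gt0// mulr_gt0. Qed.

Lemma kappaB1 : (kappa - 1) * (al - 1) = m / lam.
Proof. by rewrite /kappa addrK; field; rewrite !gt_eqF. Qed.

(* [spread (s - t)] is the integral of [gamma t ^ (-1 / (al - 1))] over [t, s];
   by Hoelder, covering a distance D within a delay tau costs at least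
   D ^ al / spread tau ^ (al - 1). *)
Definition spread (tau : K) : K := ((1 + lam * tau) `^ kappa - 1) / (lam * kappa).

Lemma spread0 : spread 0 = 0.
Proof. by rewrite /spread mulr0 addr0 powR1 subrr mul0r. Qed.

Lemma is_derive_spread (tau : K) : 0 < 1 + lam * tau ->
  is_derive tau 1 spread ((1 + lam * tau) `^ (kappa - 1)).
Proof.
move=> w0; have k0 : kappa != 0 by rewrite gt_eqF// (lt_trans ltr01 kappa_gt1).
have lin : is_derive tau 1 (fun x : K => 1 + lam * x) lam.
  by apply: is_derive_eq; rewrite /GRing.scale/=; ring.
have pw : is_derive tau 1 (fun x : K => (1 + lam * x) `^ kappa)
    (kappa * (1 + lam * tau) `^ (kappa - 1) * lam).
  exact: is_derive_powR_comp.
have -> : spread = (lam * kappa)^-1 \*: ((fun x : K => (1 + lam * x) `^ kappa) - cst 1).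
  by apply/funext => x; rewrite /spread /= mulrC.
apply: is_derive_eq; rewrite /GRing.scale/=; field.
by rewrite k0 gt_eqF.
Qed.

Lemma le_spread (x y : K) : 0 <= x -> x <= y -> y - x <= spread y - spread x.
Proof.
move=> x0 xy; have [c /andP[xc _] ->] : exists2 c, x <= c <= y &
    spread y - spread x = (1 + lam * c) `^ (kappa - 1) * (y - x).
  apply: (is_derive_mean_value (df := fun c => (1 + lam * c) `^ (kappa - 1))) => //.
  move=> z /andP[xz _]; apply: is_derive_spread.
  by rewrite ltr_pwDl// mulr_ge0 ?(ltW lam0)// (le_trans x0).
rewrite ler_peMl ?subr_ge0// -[leLHS](powRr0 (1 + lam * c)) ler_powR//.
  by rewrite lerDl mulr_ge0 ?(ltW lam0)// (le_trans x0).
by rewrite subr_ge0 ltW// kappa_gt1.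
Qed.

Lemma spread_gt0 (tau : K) : 0 < tau -> 0 < spread tau.
Proof.
by move=> tau0; have := le_spread (lexx 0) (ltW tau0); rewrite spread0; lra.
Qed.

(** The exponents combine through al (kappa - 1) - m / lam = kappa - 1: moving proportionally to the
    rate of [spread] produces discounted effort proportional to that same rate. *)
Lemma discounted_effort (u p : K) : 0 < u -> 0 <= p ->
  u `^ (- (m / lam)) * (p * u `^ (kappa - 1)) `^ al = p `^ al * u `^ (kappa - 1).
Proof.
move=> u0 p0; rewrite powRM ?powR_ge0// mulrCA -powRrM -powRD; last first.
  by rewrite (gt_eqF u0) implybT.
by congr (_ * _ `^ _); rewrite -kappaB1; ring.
Qed.

(** Young's inequality for the speed [q] measured relative to the rate of [spread]. The bound is
    affine in [v], so its integral over a plan depends only on the displacement. *)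
Lemma discounted_effort_ge (u p v : K) : 0 < u -> 0 <= p -> 0 <= v ->
  al * p `^ (al - 1) * v - (al - 1) * p `^ al * u `^ (kappa - 1) <=
  u `^ (- (m / lam)) * v `^ al.
Proof.
move=> u0 p0 v0; pose q := v / u `^ (kappa - 1).
have uk0 : 0 < u `^ (kappa - 1) by exact: powR_gt0.
have q0 : 0 <= q by rewrite divr_ge0// ltW.
have -> : v = q * u `^ (kappa - 1) by rewrite /q divfK// gt_eqF.
rewrite discounted_effort//; have := young_powR al1 p0 q0.
by rewrite -(ler_pM2r uk0); lra.
Qed.

Definition plan_cost (t T : K) (y : K -> K) : \bar K :=
  (\int[leb]_(s in `[t, T])
    ((hyperbolic_discount lam m t s)%:E * effort_cost al (derive1 y s)))%E.

Lemma effort_cost_ge0 (v : K) : (0 <= effort_cost al v)%E.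
Proof. by rewrite /effort_cost; case: ifPn => // _; rewrite lee_fin powR_ge0. Qed.

Lemma plan_cost_integrand_ge0 (t s v : K) :
  (0 <= (hyperbolic_discount lam m t s)%:E * effort_cost al v)%E.
Proof. by rewrite mule_ge0 ?effort_cost_ge0// lee_fin powR_ge0. Qed.

Lemma plan_cost_ge0 (t T : K) (y : K -> K) : (0 <= plan_cost t T y)%E.
Proof. by apply: integral_ge0 => s _; exact: plan_cost_integrand_ge0. Qed.

Lemma plan_cost_integrand_ge (t s v p : K) : t <= s -> 0 <= p ->
  ((al * p `^ (al - 1) * v - (al - 1) * p `^ al * (1 + lam * (s - t)) `^ (kappa - 1))%:E
   <= (hyperbolic_discount lam m t s)%:E * effort_cost al v)%E.
Proof.
move=> ts p0; have u0 : 0 < 1 + lam * (s - t).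
  by rewrite ltr_pwDl// mulr_ge0 ?(ltW lam0)// subr_ge0.
rewrite /effort_cost; case: ifPn => [v0|_].
  by rewrite -EFinM lee_fin discounted_effort_ge.
by rewrite gt0_muley ?leey// lte_fin powR_gt0.
Qed.

Lemma is_derive_spread_shift (t s : K) : t <= s ->
  is_derive s 1 (fun s => spread (s - t)) ((1 + lam * (s - t)) `^ (kappa - 1)).
Proof.
move=> ts; have u0 : 0 < 1 + lam * (s - t).
  by rewrite ltr_pwDl// mulr_ge0 ?(ltW lam0)// subr_ge0.
have lin : is_derive s 1 (fun x : K => x - t) 1.
  by apply: is_derive_eq; ring.
rewrite -[X in is_derive _ _ _ X]mulr1.
exact: (@is_derive1_comp _ spread (fun x => x - t) s _ _ (is_derive_spread u0) lin).
Qed.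

Lemma spread_rate_continuous (t c d : K) : t <= c ->
  {within `[c, d], continuous (fun s => (1 + lam * (s - t)) `^ (kappa - 1))}.
Proof.
move=> tc; apply: (is_derive_within_continuous (df := fun s =>
  (kappa - 1) * (1 + lam * (s - t)) `^ (kappa - 1 - 1) * lam)) => s /andP[cs _].
have u0 : 0 < 1 + lam * (s - t).
  by rewrite ltr_pwDl// mulr_ge0 ?(ltW lam0)// subr_ge0 (le_trans tc).
have lin : is_derive s 1 (fun x : K => 1 + lam * (x - t)) lam.
  by apply: is_derive_eq; rewrite /GRing.scale/=; ring.
exact: is_derive_powR_comp.
Qed.

End Effort.

(** * Lower bounds for the cost of arbitrary plans *)

Section PlanCost.
Context {K : realType}.
Variables (al lam m : K).
Hypotheses (al1 : 1 < al) (lam0 : 0 < lam) (m0 : 0 < m).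
Notation leb := (@lebesgue_measure K).
Notation spread := (spread al lam m).
Notation kappa := (kappa al lam m).

Lemma spread_rate_integrable (t a b : K) : t <= a ->
  leb.-integrable `]a, b] (EFin \o (fun s => (1 + lam * (s - t)) `^ (kappa - 1))).
Proof.
move=> ta; have ri : leb.-integrable `[a, b]
    (EFin \o (fun s => (1 + lam * (s - t)) `^ (kappa - 1))).
  apply: continuous_compact_integrable; first exact: segment_compact.
  exact: spread_rate_continuous.
by apply: integrableS ri => //; apply: subset_itvr; rewrite bnd_simp.
Qed.

Lemma spread_rate_integral (t a b : K) : t <= a -> a <= b ->
  \int[leb]_(s in `]a, b]) ((1 + lam * (s - t)) `^ (kappa - 1)) =
  spread (b - t) - spread (a - t).
Proof.
move=> ta ab; rewrite Rintegral_itv_obnd_cbnd; last exact: spread_rate_integrable.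
have dG x : a <= x <= b -> is_derive x 1 (fun s => spread (s - t))
    ((1 + lam * (x - t)) `^ (kappa - 1)).
  by move=> /andP[ax _]; apply: is_derive_spread_shift => //; exact: le_trans ax.
have := is_derive_integral ab dG (@spread_rate_continuous _ al lam m lam0 t a b ta).
by rewrite /Rintegral => ->.
Qed.

Variables (t T : K) (y : K -> K).
Hypotheses (tT : t < T) (acy : absolutely_continuous t T y).

(** With [c = t] this bounds the cost of a whole plan; with different multipliers on the two sides
    of [c] it detects a plan that starts too fast. *)
Lemma plan_cost_two_pieces (c p q : K) : t <= c -> c <= T -> 0 <= p -> 0 <= q ->
  ((al * p `^ (al - 1) * (y c - y t) - (al - 1) * p `^ al * spread (c - t)
    + (al * q `^ (al - 1) * (y T - y c)
      - (al - 1) * q `^ al * (spread (T - t) - spread (c - t))))%:E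
   <= plan_cost al lam m t T y)%E.
Proof.
move=> tc cT p0 q0.
have [rho [rhoi rhoE rhod]] := absolutely_continuous_density tT acy.
pose r s := (1 + lam * (s - t)) `^ (kappa - 1).
pose L (u v s : K) := u * rho s - v * r s.
have Li u v a b : t <= a -> leb.-integrable `]a, b] (EFin \o L u v).
  move=> ta; rewrite (_ : _ \o _ =
    (fun s => u%:E * (EFin \o rho) s - v%:E * (EFin \o r) s)%E); last first.
    by apply/funext => s /=; rewrite /L EFinB !EFinM.
  apply: integrableB => //; apply: integrableZl => //.
    exact: integrableS rhoi.
  exact: spread_rate_integrable.
have LE u v a b : t <= a -> a <= b -> b <= T ->
    \int[leb]_(s in `]a, b]) L u v s =
    u * (y b - y a) - v * (spread (b - t) - spread (a - t)).
  move=> ta ab bT.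
  have ri : leb.-integrable `]a, b] (EFin \o rho) by exact: integrableS rhoi.
  have si : leb.-integrable `]a, b] (EFin \o r) by exact: spread_rate_integrable.
  rewrite RintegralB//; first by rewrite !RintegralZl// -rhoE// spread_rate_integral.
  - exact: (@integrableZl _ _ _ leb _ _ u _ ri).
  - exact: (@integrableZl _ _ _ leb _ _ v _ si).
pose P := al * p `^ (al - 1); pose Q := al * q `^ (al - 1).
pose P' := (al - 1) * p `^ al; pose Q' := (al - 1) * q `^ al.
(* [J] is the bound with multiplier [q] on all of []t, T]] plus a correction on []t, c]] that turns
   [q] into [p] there. *)
pose J2 : K -> K := L (P - Q) (P' - Q') \_ `]t, c].
pose J1 : K -> K := L Q Q'.
pose J s := J1 s + J2 s.
have sub : `]t, T] `&` `]t, c] = `]t, c]%classic :> set K.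
  by rewrite setIidr//; apply: subset_itvl; rewrite bnd_simp.
have Ji1 : leb.-integrable `]t, T] (EFin \o J2).
  rewrite -restrict_EFin; apply/integrable_restrict => //; rewrite sub.
  exact: Li.
have Ji : leb.-integrable `]t, T] (EFin \o J).
  rewrite (_ : _ \o _ = (EFin \o J1) \+ (EFin \o J2))%E//.
  by apply: integrableD => //; exact: Li.
have -> : P * (y c - y t) - P' * spread (c - t) +
    (Q * (y T - y c) - Q' * (spread (T - t) - spread (c - t))) =
    \int[leb]_(s in `]t, T]) J s.
  rewrite RintegralD//; last exact: Li.
  rewrite /J1 /J2.
  rewrite -Rintegral_mkcondr sub !LE//; last exact: ltW.
  by rewrite subrr spread0; ring.
apply: (@le_trans _ _ (\int[leb]_(s in `]t, T])
    ((hyperbolic_discount lam m t s)%:E * effort_cost al (derive1 y s)))%E); last first.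
  apply: ge0_le_integral_subset => //.
  - by apply: subset_itvr; rewrite bnd_simp.
  - by move=> s _; exact: plan_cost_integrand_ge0.
  - by move=> s _; exact: plan_cost_integrand_ge0.
apply: le_integral_lower => //.
  by move=> s _; exact: plan_cost_integrand_ge0.
have aeF : Filter (almost_everywhere leb) by exact: (ae_filter_ringOfSetsType leb).
(* The density gives the derivative only inside []t, T[], so the endpoint is discarded as a null
   set. *)
have neT : {ae leb, forall s, s != T}.
  exists [set T]; split; [exact: measurable_set1|exact: lebesgue_measure_set1|].
  by move=> s /= /negP; rewrite negbK => /eqP.
apply: filterS2 rhod neT => s rhos sT; rewrite /= in_itv/= => /andP[ts sT'].
have {}sT : s < T by rewrite lt_neqAle sT.
have dys : derive1 y s = rho s.
  rewrite derive1E; have /rhos H : s \in `]t, T[ by rewrite in_itv/= ts.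
  by rewrite (@derive_val _ _ _ _ _ _ _ H).
have [sc|cs] := leP s c.
  rewrite /J /J1 /J2 patchE mem_set; last by rewrite /= in_itv/= ts.
  have -> : L Q Q' s + L (P - Q) (P' - Q') s = P * rho s - P' * r s.
    by rewrite /L; ring.
  by rewrite -dys; apply: plan_cost_integrand_ge => //; exact: ltW.
rewrite /J /J1 /J2 patchE memNset; last by rewrite /= in_itv/= ts leNgt cs.
rewrite addr0 /L -dys; apply: plan_cost_integrand_ge => //; exact: ltW.
Qed.

End PlanCost.

(** * Optimal plans *)

Section OptimalPlans.
Context {K : realType}.
Variables (al lam m : K).
Hypotheses (al1 : 1 < al) (lam0 : 0 < lam) (m0 : 0 < m).
Notation leb := (@lebesgue_measure K).
Notation spread := (spread al lam m).
Notation kappa := (kappa al lam m).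

Let al_gt0 : 0 < al. Proof. exact: lt_trans ltr01 al1. Qed.

Lemma is_derive_right_derivative (f : K -> K) (t v : K) :
  is_derive t 1 f v -> right_derivative f t v.
Proof.
move=> [df <-]; rewrite /right_derivative.
have H : (h^-1 *: (f (h *: 1 + t) - f t)) @[h --> 0^'] --> 'D_1 f t by exact: df.
have -> : (fun h : K => h^-1 * (f (t + h) - f t)) =
    (fun h : K => h^-1 *: (f (h *: 1 + t) - f t)).
  by apply/funext => h; rewrite /GRing.scale/= mulr1 (addrC h).
exact: cvg_dnbhs_at_right H.
Qed.

(** The equality case of [discounted_effort_ge]. Since [spread] has slope 1 at 0, [p] is the initial
    speed. *)
Definition steady_plan (t x p s : K) : K := x + p * spread (s - t).

Lemma is_derive_steady_plan (t x p s : K) : t <= s ->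
  is_derive s 1 (steady_plan t x p) (p * (1 + lam * (s - t)) `^ (kappa - 1)).
Proof.
move=> ts; have H := is_derive_spread_shift al1 lam0 m0 ts.
have -> : steady_plan t x p = cst x + (p \*: (fun s => spread (s - t))) by [].
by apply: is_derive_eq; rewrite add0r.
Qed.

Lemma steady_plan_admissible (t T x p : K) : 0 <= p -> t <= T ->
  admissible T t x (steady_plan t x p).
Proof.
move=> p0 tT; split; last by rewrite /steady_plan subrr spread0 mulr0 addr0.
apply: (@lipschitz_absolutely_continuous _ _ _ _
  (p * (1 + lam * (T - t)) `^ (kappa - 1))) => a b ta ab bT.
have D c : a <= c <= b -> is_derive c 1 (steady_plan t x p)
    (p * (1 + lam * (c - t)) `^ (kappa - 1)).
  by move=> /andP[ac _]; apply: is_derive_steady_plan; exact: le_trans ac.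
have [c /andP[ac cb] ->] := is_derive_mean_value ab D.
have u0 : 0 <= 1 + lam * (c - t).
  by rewrite addr_ge0// mulr_ge0 ?(ltW lam0)// subr_ge0 (le_trans ta).
rewrite ger0_norm; last first.
  by rewrite !mulr_ge0 ?powR_ge0 ?subr_ge0.
rewrite ler_wpM2r ?subr_ge0// ler_wpM2l// ge0_ler_powR ?nnegrE//.
- by rewrite subr_ge0 ltW// kappa_gt1.
- by rewrite addr_ge0// mulr_ge0 ?(ltW lam0)// subr_ge0.
- by rewrite lerD2l ler_wpM2l ?(ltW lam0)// lerD2r (le_trans cb).
Qed.

Lemma steady_plan_cost (t T x p : K) : 0 <= p -> t <= T ->
  plan_cost al lam m t T (steady_plan t x p) = (p `^ al * spread (T - t))%:E.
Proof.
move=> p0 tT.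
have D c : t <= c <= T -> is_derive c 1 (p `^ al \*: (fun s => spread (s - t)))
    (p `^ al * (1 + lam * (c - t)) `^ (kappa - 1)).
  move=> /andP[tc _]; have H := is_derive_spread_shift al1 lam0 m0 tc.
  exact: is_deriveZ.
have C : {within `[t, T], continuous
    (fun c => p `^ al * (1 + lam * (c - t)) `^ (kappa - 1))}.
  move=> s; apply: cvgM; first exact: cvg_cst.
  exact: (spread_rate_continuous (al := al) (m := m) lam0).
have := is_derive_integral tT D C; rewrite /= subrr spread0 scaler0 subr0 => <-.
apply: eq_integral => s; rewrite inE/= in_itv/= => /andP[ts sT].
have u0 : 0 < 1 + lam * (s - t).
  by rewrite ltr_pwDl// mulr_ge0 ?(ltW lam0)// subr_ge0.
have H := is_derive_steady_plan x p ts.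
rewrite derive1E (@derive_val _ _ _ _ _ _ _ H) /effort_cost.
by rewrite mulr_ge0 ?powR_ge0// -EFinM discounted_effort.
Qed.

Lemma steady_plan_right_derivative (t x p : K) :
  right_derivative (steady_plan t x p) t p.
Proof.
apply: is_derive_right_derivative.
have := is_derive_steady_plan x p (lexx t).
by rewrite subrr mulr0 addr0 powR1 mulr1.
Qed.

(* Splitting the plan at [t + h] and using the strict Young inequality on the
   first piece shows that the plan cannot run ahead of the steady one. *)
Lemma cheap_plan_slope_le (t T p v : K) (y : K -> K) : t < T -> 0 <= p ->
  absolutely_continuous t T y ->
  (plan_cost al lam m t T y <= (p `^ al * spread (T - t))%:E)%E ->
  p `^ (al - 1) * (p * spread (T - t) - (y T - y t)) <= 0 ->
  right_derivative y t v -> v <= p.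
Proof.
move=> tT p0 acy costy disp dy.
have ahead c : t < c -> c <= T -> y c - y t <= p * spread (c - t).
  move=> tc cT; rewrite leNgt; apply/negP => far.
  have g0 : 0 < spread (c - t) by apply: spread_gt0 => //; rewrite subr_gt0.
  set g := spread (c - t) in far g0 *.
  pose q := (y c - y t) / g.
  have qE : y c - y t = q * g by rewrite /q divfK// gt_eqF.
  have pq : p < q by rewrite /q ltr_pdivlMr.
  have q0 : 0 <= q by exact: le_trans (ltW pq).
  have := plan_cost_two_pieces al1 lam0 m0 tT acy (ltW tc) cT q0 p0.
  move=> /le_trans/(_ costy); rewrite lee_fin -/g.
  have qq : q `^ al = q `^ (al - 1) * q by rewrite mulrC mulr_powRB1.
  have pp : p `^ al = p `^ (al - 1) * p by rewrite mulrC mulr_powRB1.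
  have -> : y T - y c = (y T - y t) - q * g by rewrite -qE; ring.
  have := young_powR_lt al1 p0 pq; rewrite -(ltr_pM2r g0) qE.
  (* The product form of [disp] covers two uses: for [p = 0] it holds trivially, and for [p > 0] it
     says that [y] goes at least as far as the steady plan. *)
  have := ler_wpM2l (ltW al_gt0) disp; rewrite mulr0 qq pp.
  by set S := spread (T - t); lra.
have dp := @steady_plan_right_derivative t 0 p.
rewrite /right_derivative in dy dp.
apply: (ler_cvg_to dy dp); near=> h.
have h0 : 0 < h by near: h; exact: nbhs_right_gt.
rewrite ler_pM2l ?invr_gt0// /steady_plan subrr spread0 mulr0 !add0r subr0.
apply: ahead; first by rewrite ltrDl.
rewrite -lerBrDl; near: h; apply: nbhs_right_le; rewrite subr_gt0//.
Unshelve. all: by end_near. Qed.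

Variables (T R theta : K).
Hypothesis R0 : 0 < R.

Definition pace (t x : K) : K := (theta - x) / spread (T - t).

(** The inequality is weak because of the tie-breaking rule: an indifferent agent keeps working. *)
Definition worthwhile (t x : K) : Prop :=
  pace t x `^ al * spread (T - t) <= hyperbolic_discount lam m t T * R.

Notation opt := (optimal_plan T R al (hyperbolic_discount lam m) theta).
Notation gam := (hyperbolic_discount lam m).

Lemma perceived_costE (t : K) (y : K -> K) : perceived_cost T R al gam theta t y =
  (plan_cost al lam m t T y - (gam t T * R * (theta <= y T)%R%:R)%:E)%E.
Proof. by []. Qed.

Lemma paceK (t x : K) : t < T -> pace t x * spread (T - t) = theta - x.
Proof. by move=> tT; rewrite /pace divfK// gt_eqF// spread_gt0// subr_gt0. Qed.

Lemma pace_cost_le (t x : K) (y : K -> K) : t < T -> x <= theta ->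
  absolutely_continuous t T y -> y t = x -> theta <= y T ->
  ((pace t x `^ al * spread (T - t))%:E <= plan_cost al lam m t T y)%E.
Proof.
move=> tT xth acy yt yT.
have g0 : 0 < spread (T - t) by apply: spread_gt0 => //; rewrite subr_gt0.
have p0 : 0 <= pace t x by rewrite /pace divr_ge0 ?subr_ge0// ltW.
apply: le_trans (plan_cost_two_pieces al1 lam0 m0 tT acy (lexx t) (ltW tT) p0 p0).
rewrite lee_fin !subrr spread0 yt !mulr0 subr0 add0r subr0.
have pp : pace t x `^ al = pace t x `^ (al - 1) * pace t x.
  by rewrite mulrC mulr_powRB1.
have : al * pace t x `^ (al - 1) * (theta - x) <= al * pace t x `^ (al - 1) * (y T - x).
  by rewrite ler_wpM2l ?lerD2r// mulr_ge0 ?powR_ge0// ltW.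
by rewrite -(paceK x tT) pp; lra.
Qed.

(** Comparison with the idle plan shows that an optimal plan which misses the goal, or starts at or
    beyond it, has no positive cost and hence no positive slope. A plan that reaches the goal from
    below is compared with the steady plan at [pace]. *)
Lemma optimal_slope (t x v : K) (y : K -> K) : t < T -> opt t x y ->
  right_derivative y t v ->
  v <= 0 \/ [/\ x < theta, v <= pace t x & worthwhile t x].
Proof.
move=> tT [[acy yt] yopt] dy.
have al0 : al != 0 by rewrite gt_eqF// (lt_trans ltr01).
have g0 : 0 < spread (T - t) by apply: spread_gt0 => //; rewrite subr_gt0.
have gR0 : 0 < gam t T * R.
  rewrite mulr_gt0// powR_gt0// ltr_pwDl// mulr_ge0 ?(ltW lam0)//.
  by rewrite subr_ge0 ltW.
have idle := yopt _ (steady_plan_admissible x (lexx 0) (ltW tT)).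
have {idle} : (plan_cost al lam m t T y - (gam t T * R * (theta <= y T)%R%:R)%:E <=
    - (gam t T * R * (theta <= x)%R%:R)%:E)%E.
  apply: le_trans idle _.
  rewrite perceived_costE steady_plan_cost ?(ltW tT)//.
  by rewrite powR0// mul0r add0e /steady_plan mul0r addr0.
have idle_slope : (plan_cost al lam m t T y <= 0)%E -> v <= 0.
  move=> c0; apply: (cheap_plan_slope_le tT (lexx 0) acy _ _ dy).
    by rewrite powR0// mul0r.
  by rewrite powR0 ?mul0r// gt_eqF// subr_gt0.
case: (leP theta (y T)) => yT; case: (leP theta x) => xth; rewrite ?mulr1 ?mulr0.
- by rewrite leeBlDr// addeC subee// => /idle_slope; left.
- rewrite leeBlDr// oppe0 add0e => idle; right.
  have xth' := ltW xth.
  have p0 : 0 <= pace t x by rewrite /pace divr_ge0 ?subr_ge0// ltW.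
  have lb := pace_cost_le tT xth' acy yt yT.
  split => //; last by have := le_trans lb idle; rewrite lee_fin.
  have := yopt _ (steady_plan_admissible x p0 (ltW tT)).
  rewrite !perceived_costE.
  rewrite steady_plan_cost ?(ltW tT)// /steady_plan paceK// (addrC x) subrK lexx yT.
  rewrite leeD2rE// => costy; apply: (cheap_plan_slope_le tT p0 acy costy _ dy).
  rewrite paceK// mulr_ge0_le0 ?powR_ge0// yt; lra.
- rewrite sube0 => cy; left; apply: idle_slope; apply: le_trans cy _.
  by rewrite leeNl oppe0 lee_fin ltW.
- by rewrite sube0 oppe0 => /idle_slope; left.
Qed.

(** A plan that misses the goal has nonnegative perceived cost, and one that reaches it costs at
    least as much as the steady plan; [optimal_slope] handles the tie-breaking. *)
Lemma worthwhile_chosen_velocity (t x : K) : t < T -> x < theta -> worthwhile t x ->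
  chosen_velocity T R al (hyperbolic_discount lam m) theta t x (pace t x).
Proof.
move=> tT xth wtx; have g0 : 0 < spread (T - t) by apply: spread_gt0 => //; rewrite subr_gt0.
have p0 : 0 <= pace t x by rewrite /pace divr_ge0 ?subr_ge0// ltW.
split; last by move=> z w oz dz; have [|[]//] := optimal_slope tT oz dz; lra.
exists (steady_plan t x (pace t x)); last exact: steady_plan_right_derivative.
split; first by apply: steady_plan_admissible => //; exact: ltW.
move=> z [acz zt].
rewrite !perceived_costE.
rewrite steady_plan_cost ?(ltW tT)// /steady_plan paceK// (addrC x) subrK lexx.
have [zT|zT] := leP theta (z T).
  by apply: leeB => //; apply: pace_cost_le => //; exact: ltW.
rewrite mulr0 sube0 mulr1; apply: le_trans (plan_cost_ge0 _ _ _ _ _ _).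
by rewrite -EFinB lee_fin subr_le0.
Qed.

End OptimalPlans.

(** * The pursuit path *)

Section Remaining.
Context {K : realType}.
Variables (T al lam m : K).
Hypotheses (T0 : 0 < T) (al1 : 1 < al) (lam0 : 0 < lam) (m0 : 0 < m).
Notation leb := (@lebesgue_measure K).
Notation spread := (spread al lam m).
Notation kappa := (kappa al lam m).
Notation eta := (Defs.eta T al lam m).

Let al_gt0 : 0 < al. Proof. exact: lt_trans ltr01 al1. Qed.
Let kappa1 : 1 < kappa. Proof. exact: kappa_gt1. Qed.
Let kappa_gt0 : 0 < kappa. Proof. exact: lt_trans ltr01 kappa1. Qed.

Definition horizon (t : K) : K := 1 + lam * (T - t).

Lemma horizon_gt1 (t : K) : t < T -> 1 < horizon t.
Proof. by move=> tT; rewrite /horizon ltrDl mulr_gt0// subr_gt0. Qed.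

Lemma horizon_gt0 (t : K) : t < T -> 0 < horizon t.
Proof. by move=> /horizon_gt1; apply: lt_trans. Qed.

Lemma is_derive_horizon (t : K) : is_derive t 1 horizon (- lam).
Proof. by apply: is_derive_eq; rewrite /GRing.scale/=; ring. Qed.

(** The integrand of [eta]; before [T] it is inversely proportional to [spread (T - t)]. *)
Definition rate (t : K) : K := (horizon t `^ kappa - 1)^-1.

Lemma horizon_powB1_gt0 (t : K) : t < T -> 0 < horizon t `^ kappa - 1.
Proof.
by move=> tT; rewrite subr_gt0 powR_gt1// horizon_gt1.
Qed.

Lemma spread_rate (t : K) : t < T -> spread (T - t) = (lam * kappa * rate t)^-1.
Proof. by move=> tT; rewrite /spread /rate -/(horizon t) [RHS]invfM invrK mulrC. Qed.

Lemma rate_gt0 (t : K) : t < T -> 0 < rate t.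
Proof. by move=> tT; rewrite /rate invr_gt0 horizon_powB1_gt0. Qed.

Lemma is_derive_rate (t : K) : t < T ->
  is_derive t 1 rate (lam * kappa * horizon t `^ (kappa - 1) * rate t ^+ 2).
Proof.
move=> tT; have hw := is_derive_horizon t.
have dw := @is_derive_powR_comp K kappa t _ horizon (horizon_gt0 tT) hw.
have nz : horizon t `^ kappa - 1 != 0 by rewrite gt_eqF// horizon_powB1_gt0.
have db : is_derive t 1 (fun s => horizon s `^ kappa - 1)
    (kappa * horizon t `^ (kappa - 1) * - lam).
  by apply: is_derive_eq; rewrite subr0.
have H := @is_deriveV _ (fun s => horizon s `^ kappa - 1) t _ 1 nz db.
apply: (is_derive_eq H); rewrite /rate /GRing.scale/= exprVn; ring.
Qed.

(** Starting at -1 leaves room to the left of 0, so that the primitive has a two-sided derivative at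
    0 as well. *)
Definition rate_primitive (t : K) : K := \int[leb]_(s in `[-1, t]) rate s.

Lemma rate_continuous (a b : K) : b < T -> {within `[a, b], continuous rate}.
Proof.
move=> bT; apply: (is_derive_within_continuous (df := fun t =>
  lam * kappa * horizon t `^ (kappa - 1) * rate t ^+ 2)) => t /andP[_ tb].
by apply: is_derive_rate; exact: le_lt_trans bT.
Qed.

Lemma is_derive_rate_primitive (t : K) : -1 < t -> t < T ->
  is_derive t 1 rate_primitive (rate t).
Proof.
(* The integrand blows up at [T], so integrability is claimed only up to a midpoint. *)
move=> t1 tT; pose u := (t + T) / 2.
have tu : t < u by rewrite /u; lra.
have uT : u < T by rewrite /u; lra.
have ri : leb.-integrable `[-1, u] (EFin \o rate).
  apply: continuous_compact_integrable; first exact: segment_compact.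
  exact: rate_continuous.
have rc : {for t, continuous rate}.
  have [dr _] := is_derive_rate tT.
  exact/differentiable_continuous/derivable1_diffP.
have [d1 d2] := continuous_FTC1_closed tu ri t1 rc.
by apply: DeriveDef; [exact: d1|rewrite -derive1E].
Qed.

Lemma eta_rate_primitive (t : K) : 0 <= t -> t < T ->
  eta t = rate_primitive t - rate_primitive 0.
Proof.
move=> t0 tT; have D x : 0 <= x <= t -> is_derive x 1 rate_primitive (rate x).
  move=> /andP[x0 xt]; apply: is_derive_rate_primitive; last exact: le_lt_trans tT.
  by apply: lt_le_trans x0; rewrite ltrN10.
have := is_derive_integral t0 D (@rate_continuous 0 t tT).
by rewrite /Defs.eta /Rintegral => ->.
Qed.

(* The fraction of the goal that remains at time [t] while the agent pursues it. *)
Definition remaining (t : K) : K :=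
  expR (- (lam * kappa) * (rate_primitive t - rate_primitive 0)).

Lemma remaining0 : remaining 0 = 1.
Proof. by rewrite /remaining subrr mulr0 expR0. Qed.

Lemma remaining_gt0 (t : K) : 0 < remaining t. Proof. exact: expR_gt0. Qed.

Lemma is_derive_remaining (t : K) : 0 <= t -> t < T ->
  is_derive t 1 remaining (- (lam * kappa * rate t * remaining t)).
Proof.
move=> t0 tT; have t1 : -1 < t by apply: lt_le_trans t0; rewrite ltrN10.
have H := is_derive_rate_primitive t1 tT.
have L : is_derive t 1
    (fun t => - (lam * kappa) * (rate_primitive t - rate_primitive 0))
    (- (lam * kappa) * rate t).
  by apply: is_derive_eq; rewrite /GRing.scale/=; ring.
have {}H := @is_derive1_comp _ expR _ t _ _ (is_derive_expR _) L.
by apply: (is_derive_eq H); rewrite /remaining; ring.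
Qed.

(** The speed of the pursuit stays bounded although [rate] blows up at [T]. The product
    [remaining t * (1 + rate t)] decreases, because a horizon above 1 has its power [kappa - 1]
    below its power [kappa]. *)
Lemma remaining_rate_le (t : K) : 0 <= t -> t < T ->
  remaining t * rate t <= 1 + rate 0.
Proof.
move=> t0 tT; apply: (@le_trans _ _ (remaining t * (1 + rate t))).
  by rewrite ler_pM2l ?remaining_gt0// lerDr.
have -> : 1 + rate 0 = remaining 0 * (1 + rate 0) by rewrite remaining0 mul1r.
apply: (is_derive_le0_le (f := fun t => remaining t * (1 + rate t))
  (df := fun t => lam * kappa * remaining t * rate t ^+ 2 *
    (horizon t `^ (kappa - 1) - horizon t `^ kappa)) t0) => s /andP[s0 st].
  have sT : s < T by exact: le_lt_trans tT.
  have H1 := is_derive_remaining s0 sT; have H2 := is_derive_rate sT.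
  apply: is_derive_eq; rewrite /GRing.scale/=.
  have -> : horizon s `^ kappa = 1 + (rate s)^-1 by rewrite /rate invrK addrC subrK.
  by field; rewrite gt_eqF// rate_gt0.
have sT : s < T by exact: le_lt_trans tT.
apply: mulr_ge0_le0.
  by rewrite mulr_ge0 ?sqr_ge0// ltW// !mulr_gt0 ?remaining_gt0.
rewrite subr_le0 ler_powR ?(ltW (horizon_gt1 sT))//.
by rewrite lerBlDr lerDl.
Qed.

Lemma spread_le (t : K) : 0 <= t -> t < T ->
  spread (T - t) <= horizon 0 `^ (kappa - 1) * (T - t).
Proof.
move=> t0 tT.
have D x : 0 <= x <= T - t -> is_derive x 1 spread ((1 + lam * x) `^ (kappa - 1)).
  move=> /andP[x0 _]; apply: is_derive_spread => //.
  by rewrite ltr_pwDl// mulr_ge0 ?(ltW lam0).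
have Tt0 : 0 <= T - t by rewrite subr_ge0 ltW.
have [c /andP[c0 cT]] := is_derive_mean_value Tt0 D.
rewrite spread0 !subr0 => ->; rewrite ler_wpM2r// ge0_ler_powR ?nnegrE//.
- by rewrite subr_ge0 ltW.
- by rewrite addr_ge0// mulr_ge0 ?(ltW lam0).
- by rewrite ltW// horizon_gt0.
- by rewrite /horizon subr0 lerD2l ler_wpM2l ?(ltW lam0)// (le_trans cT)// lerBlDr lerDl.
Qed.

Lemma remaining_le (t : K) : 0 <= t -> t < T ->
  remaining t <= (1 + rate 0) * (lam * kappa) * spread (T - t).
Proof.
move=> t0 tT; have r0 := rate_gt0 tT; have lk : 0 < lam * kappa by rewrite mulr_gt0.
rewrite spread_rate//.
have -> : (1 + rate 0) * (lam * kappa) * (lam * kappa * rate t)^-1 =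
    (1 + rate 0) / rate t by field; rewrite !gt_eqF.
by rewrite ler_pdivlMr// remaining_rate_le.
Qed.

End Remaining.

(** * The pursuit threshold *)

Section Threshold.
Context {K : realType}.
Variables (T al lam m : K).
Hypotheses (T0 : 0 < T) (al1 : 1 < al) (lam0 : 0 < lam) (m0 : 0 < m).
Notation spread := (spread al lam m).
Notation kappa := (kappa al lam m).
Notation horizon := (horizon T lam).
Notation remaining := (remaining T al lam m).
Notation rate := (rate T al lam m).
Notation rate_primitive := (rate_primitive T al lam m).
Notation fT := (fT T al lam m).

Let al_gt0 : 0 < al. Proof. exact: lt_trans ltr01 al1. Qed.
Let al10 : 0 < al - 1. Proof. by rewrite subr_gt0. Qed.
Let kappa1 : 1 < kappa. Proof. exact: kappa_gt1. Qed.
Let kappa_gt0 : 0 < kappa. Proof. exact: lt_trans ltr01 kappa1. Qed.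

Lemma lam_kappa : lam * kappa = m / (al - 1) + lam.
Proof. by rewrite /kappa; field; rewrite !gt_eqF. Qed.

(* The agent pursues the goal iff [(theta - x) ^ al <= capacity t * R]. *)
Definition capacity (t : K) : K :=
  spread (T - t) `^ (al - 1) * horizon t `^ (- (m / lam)).

Lemma spread_remaining_gt0 (t : K) : t < T -> 0 < spread (T - t).
Proof. by move=> tT; apply: spread_gt0 => //; rewrite subr_gt0. Qed.

Lemma capacity_gt0 (t : K) : t < T -> 0 < capacity t.
Proof.
by move=> tT; rewrite mulr_gt0 ?powR_gt0 ?spread_remaining_gt0// horizon_gt0.
Qed.

(** With w the horizon, capacity is the power al - 1 of (w - w ^ (1 - kappa)) / (lam kappa). This
    increases with w, and w decreases with time. *)
Lemma capacity_nonincreasing (s t : K) : s <= t -> t < T -> capacity t <= capacity s.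
Proof.
move=> st tT; have sT : s < T by exact: le_lt_trans tT.
have capE r : r < T -> capacity r =
    ((horizon r - horizon r `^ (- (kappa - 1))) / (lam * kappa)) `^ (al - 1).
  move=> rT; have w0 := horizon_gt0 lam0 rT; have w1 := horizon_gt1 lam0 rT.
  rewrite /capacity -(kappaB1 m al1 lam0) -mulNr powRrM -powRM ?powR_ge0//; last first.
    by rewrite ltW// spread_remaining_gt0.
  congr (_ `^ _); rewrite /spread -/(horizon r) mulrAC mulrBl mul1r.
  rewrite -powRD ?(gt_eqF w0) ?implybT//.
  by rewrite (_ : kappa - (kappa - 1) = 1) ?powRr1//; [exact: ltW|ring].
have ws := horizon_gt1 lam0 sT; have wt := horizon_gt1 lam0 tT.
have wst : horizon t <= horizon s.
  by rewrite /horizon lerD2l ler_pM2l// lerD2l lerN2.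
have dec : horizon s `^ (- (kappa - 1)) <= horizon t `^ (- (kappa - 1)).
  rewrite !powRN lef_pV2 ?posrE ?powR_gt0 ?(lt_trans ltr01)//.
  by apply: ge0_ler_powR => //; rewrite ?nnegrE ?subr_ge0 ?(ltW kappa1) ?ltW// (lt_trans ltr01).
rewrite (capE t tT) (capE s sT).
apply: ge0_ler_powR; rewrite ?nnegrE ?(ltW al10)//.
- rewrite divr_ge0 ?(ltW (mulr_gt0 lam0 kappa_gt0))// subr_ge0.
  apply: (@le_trans _ _ 1); last exact: ltW.
  by rewrite -[leRHS](powRr0 (horizon t)) ler_powR ?(ltW wt)// oppr_le0 subr_ge0 ltW.
- rewrite divr_ge0 ?(ltW (mulr_gt0 lam0 kappa_gt0))// subr_ge0.
  apply: (@le_trans _ _ 1); last exact: ltW.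
  by rewrite -[leRHS](powRr0 (horizon s)) ler_powR ?(ltW ws)// oppr_le0 subr_ge0 ltW.
- rewrite ler_pM2r ?invr_gt0 ?mulr_gt0//; lra.
Qed.

Lemma worthwhileE (R theta t x : K) : t < T -> x <= theta ->
  worthwhile al lam m T R theta t x <-> (theta - x) `^ al <= capacity t * R.
Proof.
move=> tT xth; have g0 := spread_remaining_gt0 tT.
rewrite /worthwhile /pace /hyperbolic_discount -/(horizon t) /capacity.
have -> : ((theta - x) / spread (T - t)) `^ al * spread (T - t) =
    (theta - x) `^ al / spread (T - t) `^ (al - 1).
  rewrite powRM ?invr_ge0 ?subr_ge0 ?(ltW g0)// -mulrA; congr (_ * _).
  rewrite -(powR_inv1 (ltW g0)) -powRrM mulN1r -[X in _ * X](powRr1 (ltW g0)).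
  rewrite -powRD ?(gt_eqF g0) ?implybT// -[RHS]powRN; congr (_ `^ _); ring.
by rewrite ler_pdivrMr ?powR_gt0// mulrC mulrA.
Qed.

(** Along the pursuit the distance left is [theta * remaining t], so affordability at time [t]
    becomes a bound on [fT t]. *)
Lemma fTE (t : K) : 0 <= t -> t < T -> fT t = remaining t `^ al / capacity t.
Proof.
move=> t0 tT; have w0 := horizon_gt0 lam0 tT; have g0 := spread_remaining_gt0 tT.
have wk := horizon_powB1_gt0 al1 lam0 m0 tT.
rewrite /Defs.fT -/(horizon t) -/kappa eta_rate_primitive//.
have -> : (m + lam * (al - 1)) / ((al - 1) * (horizon t `^ kappa - 1)) =
    (spread (T - t))^-1.
  rewrite /spread -/(horizon t) invf_div lam_kappa.
  by field; rewrite !gt_eqF.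
have -> : (capacity t)^-1 = (spread (T - t))^-1 `^ (al - 1) * horizon t `^ (m / lam).
  rewrite /capacity [LHS]invfM powRN invrK; congr (_ * _).
  by rewrite -(powR_inv1 (ltW g0)) -powRrM mulN1r powRN.
rewrite [RHS]mulrC; congr (_ * _).
rewrite /remaining -expRM -lam_kappa; congr expR; ring.
Qed.

End Threshold.

(** * The maximum of [fT] over time *)

Section Peak.
Context {K : realType}.
Variables (T al lam m : K).
Hypotheses (T0 : 0 < T) (al1 : 1 < al) (lam0 : 0 < lam) (m0 : 0 < m).
Notation spread := (spread al lam m).
Notation kappa := (kappa al lam m).
Notation horizon := (horizon T lam).
Notation remaining := (remaining T al lam m).
Notation rate := (rate T al lam m).
Notation rate_primitive := (rate_primitive T al lam m).
Notation fT := (fT T al lam m).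
Notation x0 := (x0 al lam m).
Notation t0 := (t0 T al lam m).

Let al_gt0 : 0 < al. Proof. exact: lt_trans ltr01 al1. Qed.
Let al10 : 0 < al - 1. Proof. by rewrite subr_gt0. Qed.
Let kappa1 : 1 < kappa. Proof. exact: kappa_gt1. Qed.
Let kappa_gt0 : 0 < kappa. Proof. exact: lt_trans ltr01 kappa1. Qed.

(* The logarithmic derivative of [fT] has the sign of [slope (horizon t)]. *)
Definition slope (w : K) : K := (al - 1) * w `^ kappa - al * kappa * w + m / lam.

Lemma slope1 : slope 1 = - kappa.
Proof. by rewrite /slope powR1 -(kappaB1 m al1 lam0); ring. Qed.

(** The tangent to the power function at [b] lies below its values at [a] and [c]; a weighted sum of
    the two inequalities gives convexity. *)
Lemma slope_convex (a b c : K) : 0 <= a -> a <= b -> b <= c ->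
  slope b * (c - a) <= (c - b) * slope a + (b - a) * slope c.
Proof.
move=> a0 ab bc; have b0 : 0 <= b by exact: le_trans ab.
have c0 : 0 <= c by exact: le_trans bc.
have ha := young_powR kappa1 b0 a0; have hc := young_powR kappa1 b0 c0.
have bE : b `^ kappa = b `^ (kappa - 1) * b by rewrite mulrC mulr_powRB1.
have cb : 0 <= (c - b) * (al - 1) by rewrite mulr_ge0 ?subr_ge0 ?(ltW al1).
have ba : 0 <= (b - a) * (al - 1) by rewrite mulr_ge0 ?subr_ge0 ?(ltW al1).
have := ler_wpM2l cb ha; have := ler_wpM2l ba hc.
by rewrite /slope bE; lra.
Qed.

Lemma slope_root_exists : exists2 w, 1 < w & slope w = 0.
Proof.
(* When the power [kappa - 1] of [w] equals [c], the first two terms of [slope w] cancel and leave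
   the positive [m / lam]. *)
pose c := al * kappa / (al - 1).
have c1 : 1 < c.
  rewrite /c ltr_pdivlMr// mul1r (@lt_le_trans _ _ al)// ?ltrBlDr ?ltrDl//.
  by rewrite ler_pMr// ltW.
have k10 : 0 < kappa - 1 by rewrite subr_gt0.
pose w := c `^ (kappa - 1)^-1.
have w1 : 1 < w by rewrite powR_gt1// invr_gt0.
have sw : 0 < slope w.
  have -> : slope w = m / lam.
    rewrite /slope -(mulr_powRB1 (ltW (lt_trans ltr01 w1)) kappa_gt0).
    rewrite {2}/w -powRrM mulVf ?gt_eqF// powRr1; last by rewrite ltW// (lt_trans ltr01).
    by rewrite /c; field; rewrite !gt_eqF.
  by rewrite divr_gt0.
have sc : {within `[1, w], continuous slope}.
  apply: (is_derive_within_continuous (df := fun w =>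
    (al - 1) * (kappa * w `^ (kappa - 1)) - al * kappa)) => x /andP[x1 _].
  have xgt0 : 0 < x by exact: lt_le_trans x1.
  have H := is_derive1_powR kappa xgt0.
  by apply: is_derive_eq; rewrite /GRing.scale/=; ring.
have [|r] := IVT (ltW w1) sc (v := 0).
  rewrite slope1 ge_min le_max (ltW sw) orbT andbT oppr_le0 ltW//.
rewrite in_itv/= => /andP[r1 _] sr; exists r => //.
rewrite lt_neqAle r1 andbT; apply/eqP => E; move: sr; rewrite -E slope1.
by move/eqP; rewrite oppr_eq0 gt_eqF.
Qed.

(** Substituting w for the power [al - 1] of x turns the equation for [x0] into [slope w = 0], so a
    root of [slope] provides the element that [get] requires. *)
Lemma x0_spec : 1 < x0 `^ (al - 1) /\ slope (x0 `^ (al - 1)) = 0.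
Proof.
have eqE x : (al - 1) * x `^ (m / lam + al - 1) -
    al * (m / (lam * (al - 1)) + 1) * x `^ (al - 1) + m / lam = slope (x `^ (al - 1)).
  rewrite /slope -powRrM -/kappa (_ : (al - 1) * kappa = m / lam + al - 1)//.
  by rewrite -(kappaB1 m al1 lam0); ring.
have [w w1 sw] := slope_root_exists.
have wE : (w `^ (al - 1)^-1) `^ (al - 1) = w.
  by rewrite -powRrM mulVf ?gt_eqF// powRr1// ltW// (lt_trans ltr01).
suff [x1 xE] : [set x : K | 1 < x /\ (al - 1) * x `^ (m / lam + al - 1) -
    al * (m / (lam * (al - 1)) + 1) * x `^ (al - 1) + m / lam = 0] x0.
  by split; [exact: powR_gt1|rewrite -eqE].
apply: (@getPex K) => /=; exists (w `^ (al - 1)^-1); split.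
  by rewrite powR_gt1// invr_gt0.
by rewrite eqE wE.
Qed.

Lemma horizon_t0 : horizon t0 = x0 `^ (al - 1).
Proof. by rewrite /horizon /Defs.t0; field; rewrite gt_eqF. Qed.

Lemma t0_ltT : t0 < T.
Proof.
by rewrite /Defs.t0 ltrBlDr ltrDl divr_gt0// subr_gt0; have [] := x0_spec.
Qed.

(** The horizon lies between 1, where [slope] is negative, and the root, so convexity applies. *)
Lemma slope_le0 (t : K) : t0 <= t -> t < T -> slope (horizon t) <= 0.
Proof.
move=> tt tT; have [w01 sw0] := x0_spec; have w1 := horizon_gt1 lam0 tT.
have ww0 : horizon t <= x0 `^ (al - 1).
  by rewrite -horizon_t0 /horizon lerD2l ler_pM2l// lerD2l lerN2.
have := slope_convex ler01 (ltW w1) ww0; rewrite sw0 mulr0 addr0 slope1.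
have w0 : 0 < x0 `^ (al - 1) - 1 by rewrite subr_gt0.
rewrite mulrN => H; rewrite -(pmulr_lle0 _ w0); apply: le_trans H _.
by rewrite oppr_le0 mulr_ge0 ?subr_ge0 ?(ltW kappa_gt0).
Qed.

(** Here the root lies between 1 and the horizon: a convex function that rises from a negative value
    to 0 stays nonnegative afterwards. *)
Lemma slope_ge0 (t : K) : t <= t0 -> 0 <= slope (horizon t).
Proof.
move=> tt; have [w01 sw0] := x0_spec.
have ww0 : x0 `^ (al - 1) <= horizon t.
  by rewrite -horizon_t0 /horizon lerD2l ler_pM2l// lerD2l lerN2.
have := slope_convex ler01 (ltW w01) ww0; rewrite sw0 mul0r slope1.
have w0 : 0 < x0 `^ (al - 1) - 1 by rewrite subr_gt0.
rewrite mulrN => H; rewrite -(pmulr_rge0 _ w0).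
have := mulr_ge0 (ltW kappa_gt0) (_ : 0 <= horizon t - x0 `^ (al - 1)).
by rewrite subr_ge0 => /(_ ww0); lra.
Qed.

Definition log_fT (t : K) : K := - (al - 1) * ln (spread (T - t))
  + m / lam * ln (horizon t) - al * lam * kappa * (rate_primitive t - rate_primitive 0).

Lemma fT_expR (t : K) : 0 <= t -> t < T -> fT t = expR (log_fT t).
Proof.
move=> tge0 tT; have w0 := horizon_gt0 lam0 tT.
have g0 := spread_remaining_gt0 al1 lam0 m0 tT.
rewrite fTE// /remaining -expRM /capacity /powR !gt_eqF// -expRD -expRN -expRD.
by rewrite /log_fT; congr expR; ring.
Qed.

Lemma is_derive_log_fT (t : K) : 0 <= t -> t < T ->
  is_derive t 1 log_fT (slope (horizon t) / (kappa * horizon t * spread (T - t))).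
Proof.
move=> tge0 tT; have w0 := horizon_gt0 lam0 tT.
have g0 := spread_remaining_gt0 al1 lam0 m0 tT.
have t1 : -1 < t by apply: lt_le_trans tge0; rewrite ltrN10.
have H1 := is_derive_rate_primitive al1 lam0 m0 t1 tT.
have H2 := @is_derive1_comp _ (@ln K) horizon t _ _ (is_derive1_ln w0)
  (is_derive_horizon T lam t).
have dT : is_derive t 1 (fun s : K => T - s) (-1).
  by apply: is_derive_eq; ring.
have H3 := @is_derive1_comp _ spread (fun s => T - s) t _ _
  (is_derive_spread al1 lam0 m0 w0) dT.
have H4 := @is_derive1_comp _ (@ln K) (spread \o (fun s => T - s)) t _ _
  (is_derive1_ln g0) H3.
apply: (@is_derive_eq _ _ _ (- (al - 1) \*: ((@ln K) \o (spread \o (fun s => T - s)))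
  + (m / lam) \*: ((@ln K) \o horizon)
  - (al * lam * kappa) \*: (rate_primitive - cst (rate_primitive 0)))).
rewrite /GRing.scale/= subr0 -/(horizon t).
have wk : horizon t `^ (kappa - 1) = horizon t `^ kappa / horizon t.
  by rewrite powRB ?powRr1 ?(ltW w0)// (gt_eqF w0) implybT.
have := horizon_powB1_gt0 al1 lam0 m0 tT.
(* Eliminating [m] makes the identity rational in the horizon, its power [kappa] and the
   parameters. *)
have mE : m = (kappa - 1) * (al - 1) * lam.
  by rewrite (kappaB1 m al1 lam0) divfK// gt_eqF.
rewrite /slope /rate /spread -/(horizon t) wk.
move: (horizon t `^ kappa) (horizon t) w0 kappa_gt0 mE => P w w0 k0.
move: kappa k0 => k k0 -> P1; field.
by rewrite !gt_eqF.
Qed.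

Lemma fT_le (t : K) : 0 <= t -> t < T -> fT t <= fT (Num.max t0 0).
Proof.
move=> tge0 tT; have tm0 : 0 <= Num.max t0 0 by rewrite le_max lexx orbT.
have tmT : Num.max t0 0 < T by rewrite gt_max t0_ltT.
have den r : 0 <= r -> r < T -> 0 <= (kappa * horizon r * spread (T - r))^-1.
  move=> r0 rT; have w0 := horizon_gt0 lam0 rT.
  have g0 := spread_remaining_gt0 al1 lam0 m0 rT.
  by rewrite invr_ge0 ltW//; exact: mulr_gt0 (mulr_gt0 kappa_gt0 w0) g0.
have dec a b : 0 <= a -> t0 <= a -> a <= b -> b < T -> log_fT b <= log_fT a.
  move=> a0 ta ab bT; apply: (is_derive_le0_le (f := log_fT)
    (df := fun t => slope (horizon t) / (kappa * horizon t * spread (T - t))) ab) => r /andP[ar rb].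
    by apply: is_derive_log_fT; [exact: le_trans ar|exact: le_lt_trans bT].
  have r0 : 0 <= r by exact: le_trans ar.
  have rT : r < T by exact: le_lt_trans bT.
  by rewrite mulr_le0_ge0 ?den ?slope_le0// (le_trans ta).
rewrite (fT_expR tge0 tT) (fT_expR tm0 tmT) ler_expR; have [t00|t00] := leP t0 0; first exact: dec.
have [tt|tt] := leP t t0; last by apply: dec => //; exact: ltW.
apply: (is_derive_ge0_le (f := log_fT)
  (df := fun t => slope (horizon t) / (kappa * horizon t * spread (T - t))) tt) => r /andP[tr rt].
  by apply: is_derive_log_fT; [exact: le_trans tr|exact: le_lt_trans t0_ltT].
have r0 : 0 <= r by exact: le_trans tr.
have rT : r < T by exact: le_lt_trans t0_ltT.
by rewrite mulr_ge0 ?den ?slope_ge0.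
Qed.

End Peak.

(** * Trajectories *)

Section Trajectory.
Context {K : realType}.
Variables (T R al lam m theta : K).
Hypotheses (T0 : 0 < T) (R0 : 0 < R) (al1 : 1 < al) (lam0 : 0 < lam) (m0 : 0 < m).
Hypothesis theta0 : 0 < theta.
Notation leb := (@lebesgue_measure K).
Notation spread := (spread al lam m).
Notation kappa := (kappa al lam m).
Notation horizon := (horizon T lam).
Notation remaining := (remaining T al lam m).
Notation rate := (rate T al lam m).
Notation fT := (fT T al lam m).
Notation capacity := (capacity T al lam m).
Notation pace := (pace al lam m T theta).
Notation solves z := (solves_agent_ode T R al (hyperbolic_discount lam m) theta z).

Let al_gt0 : 0 < al. Proof. exact: lt_trans ltr01 al1. Qed.
Let kappa1 : 1 < kappa. Proof. exact: kappa_gt1. Qed.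
Let kappa_gt0 : 0 < kappa. Proof. exact: lt_trans ltr01 kappa1. Qed.

(** The integral of [rate] diverges at [T], so the limit value [theta] is prescribed there. *)
Definition pursuit (t : K) : K := if t < T then theta * (1 - remaining t) else theta.

Lemma pursuit_lt (t : K) : t < T -> theta - pursuit t = theta * remaining t.
Proof. by move=> tT; rewrite /pursuit tT; ring. Qed.

Lemma pace_pursuit (t : K) : t < T ->
  pace t (pursuit t) = theta * (lam * kappa * rate t * remaining t).
Proof.
move=> tT; rewrite /pace pursuit_lt// spread_rate// invrK; ring.
Qed.

Lemma pace_pursuit_ge0 (t : K) : t < T -> 0 <= pace t (pursuit t).
Proof.
move=> tT; rewrite pace_pursuit//; have r0 := rate_gt0 al1 lam0 m0 tT.
have E0 := remaining_gt0 T al lam m t.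
by rewrite !mulr_ge0// ltW.
Qed.

Lemma is_derive_pursuit (t : K) : 0 <= t -> t < T ->
  is_derive t 1 pursuit (pace t (pursuit t)).
Proof.
move=> t0 tT; rewrite pace_pursuit//.
have H := is_derive_remaining al1 lam0 m0 t0 tT.
have D : is_derive t 1 (fun t => theta * (1 - remaining t))
    (theta * (lam * kappa * rate t * remaining t)).
  by apply: is_derive_eq; rewrite /GRing.scale/=; ring.
apply: near_eq_is_derive D; rewrite ?oner_neq0//.
near=> s; rewrite /pursuit ifT//; near: s; exact: lt_nbhsl.
Unshelve. all: by end_near. Qed.

(** Before [T] the speed is bounded by [remaining_rate_le]. On an interval ending at [T] the
    increment is the distance left, which [remaining_le] and [spread_le] bound linearly. *)
Lemma pursuit_absolutely_continuous : absolutely_continuous 0 T pursuit.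
Proof.
pose C := (1 + rate 0) * (lam * kappa).
have C0 : 0 <= C.
  by rewrite mulr_ge0 ?addr_ge0 ?mulr_ge0 ?(ltW (rate_gt0 al1 lam0 m0 T0)) ?(ltW lam0) ?(ltW kappa_gt0).
pose W := horizon 0 `^ (kappa - 1).
have W1 : 1 <= W.
  by rewrite ltW// powR_gt1 ?subr_gt0// horizon_gt1.
apply: (@lipschitz_absolutely_continuous _ _ _ _ (theta * C * W)) => x y x0 xy yT.
have [yltT|Tley] := ltP y T.
  have D c : x <= c <= y -> is_derive c 1 pursuit (pace c (pursuit c)).
    move=> /andP[xc cy]; apply: is_derive_pursuit; first exact: le_trans xc.
    exact: le_lt_trans yltT.
  have [c /andP[xc cy] ->] := is_derive_mean_value xy D.
  have c0 : 0 <= c by exact: le_trans xc.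
  have cT : c < T by exact: le_lt_trans yltT.
  rewrite ger0_norm; last by rewrite mulr_ge0 ?subr_ge0// pace_pursuit_ge0.
  rewrite ler_wpM2r ?subr_ge0// pace_pursuit//.
  apply: (@le_trans _ _ (theta * C)); last by rewrite ler_peMr// mulr_ge0 ?(ltW theta0).
  have lk : 0 <= lam * kappa by rewrite ltW// mulr_gt0.
  rewrite ler_pM2l// /C.
  by have := ler_wpM2l lk (remaining_rate_le al1 lam0 m0 c0 cT); lra.
have yE : y = T by apply: le_anti; rewrite yT Tley.
rewrite {}yE in xy *; have [xT|Tx] := ltP x T; last first.
  have -> : x = T by apply: le_anti; rewrite xy Tx.
  by rewrite !subrr normr0 mulr0.
have -> : pursuit T = theta by rewrite /pursuit ltxx.
rewrite pursuit_lt// ger0_norm; last by rewrite mulr_ge0// ltW// remaining_gt0.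
rewrite -!mulrA ler_pM2l//; apply: le_trans (remaining_le al1 lam0 m0 x0 xT) _.
by have := ler_wpM2l C0 (spread_le T0 al1 lam0 m0 x0 xT); rewrite /C /W; lra.
Qed.

Lemma pursuit_worthwhile (t : K) : 0 <= t -> t < T -> theta `^ al * fT t <= R ->
  chosen_velocity T R al (hyperbolic_discount lam m) theta t (pursuit t)
    (pace t (pursuit t)).
Proof.
move=> t0 tT fR; have E0 := remaining_gt0 T al lam m t.
have XT : pursuit t < theta by rewrite -subr_gt0 pursuit_lt// mulr_gt0.
have c0 := capacity_gt0 al1 lam0 m0 tT.
apply: worthwhile_chosen_velocity => //; apply/worthwhileE => //; first exact: ltW.
rewrite pursuit_lt// powRM ?(ltW theta0) ?(ltW E0)//.
by rewrite -ler_pdivrMl// mulrC -mulrA -fTE.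
Qed.

(** Extracts what the barrier arguments use: either no progress is made, or the goal is affordable
    and the velocity is at most the pace. *)
Lemma ae_state_velocity (z : K -> K) (a : K) : 0 <= a -> solves z ->
  {ae leb, forall t, t \in `]a, T[ -> exists v, is_derive t 1 z v /\
    (v <= 0 \/ [/\ z t < theta, v <= pace t (z t) &
      (theta - z t) `^ al <= capacity t * R])}.
Proof.
move=> a0 [_ _ aez].
have aeF : Filter (almost_everywhere leb) by exact: (ae_filter_ringOfSetsType leb).
apply: filterS aez => t zt; rewrite in_itv/= => /andP[at_ tT].
have [|v [[y oy dy] _] dz] := zt.
  by rewrite in_itv/= ltW ?(le_lt_trans a0)// ltW.
exists v; split => //.
have [|[h1 h2 h3]] := optimal_slope al1 lam0 m0 R0 tT oy dy; [by left|right].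
by split => //; apply/(worthwhileE al1 lam0 m0 R tT (ltW h1)).
Qed.

(** Ahead of the pursuit path less distance is left, so the pace is slower and the lead cannot grow.
    The velocity is controlled at every height above the path, so [delta = 1] is an arbitrary
    choice. *)
Lemma solution_le_pursuit (z : K -> K) : solves z ->
  forall t, 0 <= t <= T -> z t <= pursuit t.
Proof.
move=> sz t tT; have [acz z0 _] := sz.
rewrite -subr_le0; apply: (absolutely_continuous_barrier (h := z \- pursuit)
  (delta := 1) (a := 0) (b := T)) => //.
- exact: absolutely_continuousB acz pursuit_absolutely_continuous.
- by rewrite /= z0 /pursuit T0 remaining0 subrr mulr0 subr0.
have aeF : Filter (almost_everywhere leb) by exact: (ae_filter_ringOfSetsType leb).
apply: filterS (ae_state_velocity (lexx 0) sz) => s zs sT.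
have [v [dz vle]] := zs sT; move: sT; rewrite in_itv/= => /andP[s0 sT] /andP[zX _].
have dX := is_derive_pursuit (ltW s0) sT.
exists (v - pace s (pursuit s)); last exact: is_deriveB.
have X0 := pace_pursuit_ge0 sT.
case: vle => [|[_ vle _]]; first lra.
rewrite subr_le0 (le_trans vle)// /pace ler_pM2r ?invr_gt0 ?spread_remaining_gt0//.
by rewrite lerD2l lerN2; move: zX => /=; lra.
Qed.

Lemma pursuit_trajectory : (forall t, 0 <= t -> t < T -> theta `^ al * fT t <= R) ->
  agent_trajectory T R al (hyperbolic_discount lam m) theta pursuit.
Proof.
move=> fR; split; last by move=> z /solution_le_pursuit zX t; rewrite in_itv/=; exact: zX.
split; [exact: pursuit_absolutely_continuous| |].
  by rewrite /pursuit T0 remaining0 subrr mulr0.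
exists [set T]; split; [exact: measurable_set1|exact: lebesgue_measure_set1|].
move=> t /=; apply: contra_notP => /eqP tT; rewrite in_itv/= => /andP[t0 tleT].
have {tT tleT}tT : t < T by rewrite lt_neqAle tT.
exists (pace t (pursuit t)); last exact: is_derive_pursuit.
by apply: pursuit_worthwhile => //; exact: fR.
Qed.

(** No solution is ahead of the pursuit path at time [s], so the goal is out of affordable reach
    there; the affordable distance never grows again, and the solution cannot rise above [z s]. *)
Lemma infeasible_goal (s : K) (z : K -> K) : 0 <= s -> s < T ->
  R < theta `^ al * fT s -> solves z -> z T < theta.
Proof.
move=> s0 sT Rf sz; have [acz _ _] := sz.
have c0 := capacity_gt0 al1 lam0 m0 sT; have E0 := remaining_gt0 T al lam m s.
have zs : z s <= pursuit s by apply: solution_le_pursuit => //; rewrite s0 ltW.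
have far : theta * remaining s <= theta - z s by rewrite -pursuit_lt// lerD2l lerN2.
have D0 : 0 < theta - z s by apply: lt_le_trans far; rewrite mulr_gt0.
(* The largest distance worth covering at time [s]. *)
pose r := (capacity s * R) `^ al^-1.
have r0 : 0 <= r by exact: powR_ge0.
have rE : r `^ al = capacity s * R.
  by rewrite /r -powRrM mulVf ?gt_eqF// powRr1// ltW// mulr_gt0.
have rD : r < theta - z s.
  rewrite ltNge; apply/negP => Dr.
  have : (theta * remaining s) `^ al <= r `^ al.
    apply: ge0_ler_powR; rewrite ?nnegrE ?(ltW al_gt0)//.
      by rewrite mulr_ge0// ltW.
    exact: le_trans Dr.
  rewrite rE powRM ?(ltW theta0) ?(ltW E0)// -ler_pdivrMl// mulrC -mulrA -fTE//.
  by rewrite leNgt Rf.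
apply: (@le_lt_trans _ _ (z s)); last by rewrite -subr_gt0.
(* As long as the solution is less than [delta] above [z s], the goal is farther than [r], so only
   nonpositive velocities are possible. *)
rewrite -subr_le0; apply: (absolutely_continuous_barrier (h := z \- cst (z s))
  (delta := theta - z s - r) (a := s) (b := T)); last by rewrite lexx ltW.
- apply: absolutely_continuousB; first exact: absolutely_continuous_sub acz.
  apply: (@lipschitz_absolutely_continuous _ _ _ _ 0) => x y _ _ _.
  by rewrite subrr normr0 mul0r.
- by rewrite /= subrr.
- by rewrite subr_gt0.
have aeF : Filter (almost_everywhere leb) by exact: (ae_filter_ringOfSetsType leb).
apply: filterS (ae_state_velocity s0 sz) => t zt tT.
have [v [dz vle]] := zt tT; move: tT; rewrite in_itv/= => /andP[st tT] /andP[zst ztD].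
exists v; last by rewrite -[v]subr0; apply: is_deriveB.
case: vle => // -[zth _ wt]; exfalso.
have rt : r < theta - z t by move: ztD => /=; lra.
have : r `^ al < (theta - z t) `^ al.
  by apply: gt0_ltr_powR; rewrite ?nnegrE// subr_ge0 ltW.
rewrite rE ltNge => /negP; apply; apply: le_trans wt _.
by rewrite ler_pM2r//; apply: capacity_nonincreasing => //; exact: ltW.
Qed.

End Trajectory.

(** * The optimal goal *)

Theorem theorem7 (K : realType) (T R alpha lambda mu : K)
    (hT : 0 < T) (hR : 0 < R) (halpha : 1 < alpha)
    (hlambda : 0 < lambda) (hmu : 0 < mu) (theta : K) :
  optimal_goal T R alpha (hyperbolic_discount lambda mu) theta <->
  theta =
    if t0 T alpha lambda mu <= 0
    then R `^ (1 / alpha) * fT T alpha lambda mu 0 `^ (- (1 / alpha))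
    else R `^ (1 / alpha)
         * fT T alpha lambda mu (t0 T alpha lambda mu) `^ (- (1 / alpha)).
Proof.
have a0 : 0 < alpha by exact: lt_trans halpha.
(* The time at which [fT] peaks, where pursuit is hardest to afford. *)
pose s := Num.max (t0 T alpha lambda mu) 0.
have s0 : 0 <= s by rewrite le_max lexx orbT.
have sT : s < T by rewrite gt_max t0_ltT.
pose M := fT T alpha lambda mu s.
pose best := R `^ (1 / alpha) * M `^ (- (1 / alpha)).
have -> : (if t0 T alpha lambda mu <= 0
    then R `^ (1 / alpha) * fT T alpha lambda mu 0 `^ (- (1 / alpha))
    else R `^ (1 / alpha)
         * fT T alpha lambda mu (t0 T alpha lambda mu) `^ (- (1 / alpha))) = best.
  by rewrite /best /M /s; case: leP.
have M0 : 0 < M by rewrite /M fT_expR// expR_gt0.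
have best0 : 0 < best by rewrite mulr_gt0// powR_gt0.
(* For the goal [best] the affordability condition at time [s] is an equality; any larger goal
   violates it there. *)
have bestE : best `^ alpha = R / M.
  rewrite /best powRM ?powR_ge0// -!powRrM mulNr !div1r mulVf ?gt_eqF//.
  by rewrite powRr1 ?(ltW hR)// powR_inv1// ltW.
have best_final : final_progress T R alpha (hyperbolic_discount lambda mu) best best.
  exists (pursuit T alpha lambda mu best); last by rewrite /pursuit ltxx.
  apply: pursuit_trajectory => // t tge0 tT.
  rewrite bestE mulrAC (ler_pdivrMr _ _ M0) (ler_pM2l hR); exact: fT_le.
have le_best theta' : final_progress T R alpha (hyperbolic_discount lambda mu) theta' theta' ->
    theta' <= best.
  move=> [x [sx _] xT]; rewrite leNgt; apply/negP => lt_best.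
  have theta'0 : 0 < theta' by exact: lt_trans lt_best.
  suff : x T < theta' by rewrite xT ltxx.
  apply: (infeasible_goal hT hR halpha hlambda hmu theta'0 s0 sT _ sx).
  rewrite -ltr_pdivrMr// -bestE; apply: gt0_ltr_powR; rewrite ?nnegrE// ltW//.
split=> [[theta0 [p [+ pE]]]|->].
  rewrite {p}pE => fp pmax; apply: le_anti; rewrite (le_best _ fp)/=.
  by apply: (pmax _ _ _ best_final) => //; exact: ltW.
split; first exact: ltW.
by exists best; split => // theta' p' _ fp' pE; rewrite pE in fp' *; exact: le_best.
Qed.
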